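(* Let $n \in \mathbb{N}$ and $d \in \mathbb{N}_0$ satisfy: (i) $n$ and $d$ are both even, and at least one of them is divisible by $4$; and (ii) $d \ge 4$ and $n \ge d+4$. Then there exists a $d$-regular nut graph of order $n$ of the form $\mathrm{Cay}(\Gamma, C)$ where $\Gamma$ is either a cyclic group or a dihedral group.
   Context: For a finite group $\Gamma$ with identity $e$ and $C \subseteq \Gamma\setminus\{e\}$ closed under inversion, $\mathrm{Cay}(\Gamma, C)$ is the graph with vertex set $\Gamma$ in which $u,v$ are adjacent iff $vu^{-1}\in C$. The dihedral group of order $2m$ ($m\ge3$) is $\langle r, s \mid r^m = s^2 = e,\ srs = r^{-1}\rangle$. A nut graph is a graph with at least two vertices whose adjacency matrix has eigenvalue $0$ with multiplicity exactly one, such that the corresponding eigenvector has no zero entries. *)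

(* Defs.v *)
From HB Require Import structures.
From mathcomp Require Import all_boot all_order all_algebra all_fingroup all_solvable all_field.
Set Implicit Arguments. Unset Strict Implicit. Unset Printing Implicit Defensive.
Import GRing.Theory Num.Theory.
Local Open Scope ring_scope.

Definition cayley_adj (gT : finGroupType) (C : {set gT}) : rel gT :=
  fun u v => (v * u^-1)%g \in C.

Definition adj_matrix (T : finType) (e : rel T) : 'M[algC]_#|T| :=
  \matrix_(i < #|T|, j < #|T|) (e (enum_val i) (enum_val j))%:R.

Definition regular_graph (T : finType) (e : rel T) (d : nat) : Prop :=
  forall u : T, #|[set v | e u v]| = d.

(* Nut graph: at least two vertices, the eigenvalue 0 of the adjacency
   matrix has multiplicity exactly one (its eigenspace is 1-dimensional;
   the matrix is symmetric so this is also the algebraic multiplicity),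
   and the corresponding eigenvector has no zero entries. *)
Definition nut_graph (T : finType) (e : rel T) : Prop :=
  [/\ (2 <= #|T|)%N,
      \rank (eigenspace (adj_matrix e) 0) = 1%N
    & exists v : 'rV[algC]_#|T|,
        (v <= eigenspace (adj_matrix e) 0)%MS /\ forall i, v 0 i != 0].

(* Main.v *)
Require Import Defs.
From HB Require Import structures.
From mathcomp Require Import all_boot all_order all_algebra all_fingroup all_solvable all_field.
From mathcomp Require Import zify ring.

(* A dihedral Cayley graph on [2m] vertices with rotations [x^a], [a] in [A = -A], and reflections
   [y x^b], [b] in [B], has eigenvalues [alpha(w) +- |beta(w)|] over the [m]-th roots of unity [w], where
   [alpha] and [beta] are the sums of [w^a] and [w^b].  It is a nut graph as soon as
   [alpha(w)^2 = beta(w) beta(1/w)] holds for a single [w], which is then real, and [alpha] does not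
   vanish there.  With [|A| = |B|] this happens at [w = 1]; all other [w] are excluded modulo 2.
   If [A] and [B] share all their pairs [+-c] except [+-a] in [A] and [+-b] in [B], then
   [alpha +- beta] is congruent modulo 2 to [w^a + w^-a + w^b + w^-b].  By Frobenius, if 2 divides this
   algebraic integer at [w], it also divides it at every [w^(2^r)].  At a power of odd order [u > 1] the sum
   is congruent to a unit times [(w^(a+b) - 1) (w^(a-b) - 1)], which divides an odd integer when
   [a + b] and [a - b] are prime to [u]; at a primitive 8th root of unity with [a + b] odd its square
   is 2 modulo 4.  Hence [w^4 = 1], and the cases [w = -1], [w = +-i] depend only on parities.
   When the degree is 4 modulo 8 and 4 divides the order, [B] is taken symmetric about a half-integer instead. *)

Set Implicit Arguments. Unset Strict Implicit. Unset Printing Implicit Defensive.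
Import GRing.Theory Num.Theory.

(** * Coordinates [y ^+ b * x ^+ i] in the dihedral group *)

Section DihedralCoordinates.
Local Open Scope group_scope.

Lemma dihedral_generators m : (1 < m)%N -> exists x y : 'D_(m.*2),
  [/\ x ^+ m = 1, y ^+ 2 = 1, x * y = y * x^-1
    & forall g, exists b : bool, exists2 i, (i < m)%N & g = y ^+ b * x ^+ i].
Proof.
move=> m1.
have [_] := isoGrpP [set: 'D_(m.*2)]%G (Grp_dihedral m1) (isog_refl _).
case/existsP=> -[x y] /= /eqP[defG xm y2 xy].
have xyE : x * y = y * x^-1 by rewrite -xy conjgC.
exists x, y; split=> // g.
have defG' : <[y]> * <[x]> = [set: 'D_(m.*2)].
  rewrite -defG joingC -norm_joinEl; last by rewrite norms_cycle xy groupV cycle_id.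
  by rewrite joingC.
have : g \in <[y]> * <[x]> by rewrite defG' inE.
case/mulsgP => _ _ /cycleP[j ->] /cycleP[i ->] ->.
exists (odd j), (i %% m)%N; first by rewrite ltn_mod ltnW.
congr (_ * _).
  by rewrite -{1}(odd_double_half j) expgD -[j./2.*2]mul2n expgM y2 expg1n mulg1.
by rewrite expg_mod.
Qed.
End DihedralCoordinates.

Section DihedralElements.
Local Open Scope group_scope.
Variables (m : nat) (gT : finGroupType) (x y : gT).
Hypotheses (m1 : (1 < m)%N) (cardG : #|gT| = m.*2).
Hypotheses (xm : x ^+ m = 1) (y2 : y ^+ 2 = 1) (xy : x * y = y * x^-1).
Hypothesis gen : forall g, exists b : bool, exists2 i, (i < m)%N & g = y ^+ b * x ^+ i.

Definition dih (b : bool) (i : nat) : gT := y ^+ b * x ^+ i.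

Lemma dih_modn b i : dih b (i %% m) = dih b i.
Proof. by rewrite /dih expg_mod. Qed.

Lemma dihP g : exists b, exists2 i, (i < m)%N & g = dih b i.
Proof. by case: (gen g) => b [i im ->]; exists b, i. Qed.

(** By counting: the [2m] words cover a group of order [2m], so no two of them coincide. *)
Lemma dih_inj b b' i i' : (i < m)%N -> (i' < m)%N -> dih b i = dih b' i' -> b = b' /\ i = i'.
Proof.
move=> im im'.
pose f (p : bool * 'I_m) := dih p.1 p.2.
have : {in predT &, injective f}.
  apply/image_injP; rewrite eqn_leq leq_image_card /=.
  apply: (@leq_trans #|gT|); first by rewrite card_prod card_bool card_ord mul2n cardG.
  apply/subset_leq_card/subsetP => g _.
  case: (dihP g) => c [j jm ->]; apply/imageP.
  by exists (c, Ordinal jm).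
move=> finj e.
by have [-> ->] : (b, Ordinal im) = (b', Ordinal im') by apply: finj.
Qed.

Lemma expx_y i : x ^+ i * y = y * x ^- i.
Proof.
elim: i => [|i IHi]; first by rewrite expg0 invg1 mul1g mulg1.
by rewrite expgSr -mulgA xy mulgA IHi -mulgA -invMg -expgS -expgSr.
Qed.

Lemma expxV i : (i <= m)%N -> x ^- i = x ^+ (m - i).
Proof. by move=> im; apply: (mulgI (x ^+ i)); rewrite mulgV -expgD subnKC // xm. Qed.

Lemma yy : y * y = 1. Proof. exact: y2. Qed.

Lemma mul_rot_rot a i : dih false a * dih false i = dih false (a + i).
Proof. by rewrite /dih !mul1g expgD. Qed.

Lemma mul_rot_ref a i : (a <= m)%N -> dih false a * dih true i = dih true (m - a + i).
Proof. by move=> am; rewrite /dih !mul1g mulgA expx_y expxV // -mulgA expgD. Qed.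

Lemma mul_ref_rot b i : dih true b * dih false i = dih true (b + i).
Proof. by rewrite /dih mul1g expgD mulgA. Qed.

Lemma mul_ref_ref b i : (b <= m)%N -> dih true b * dih true i = dih false (m - b + i).
Proof.
move=> bm; rewrite /dih !(expg1 y) mul1g -mulgA [_ ^+ b * _]mulgA expx_y -mulgA.
by rewrite [y * (y * _)]mulgA yy mul1g expxV // expgD.
Qed.

Lemma inv_rot a : (a <= m)%N -> (dih false a)^-1 = dih false (m - a).
Proof. by move=> am; rewrite /dih !mul1g expxV. Qed.

Lemma inv_ref b : (b <= m)%N -> (dih true b)^-1 = dih true b.
Proof.
by move=> bm; apply/eqP; rewrite eq_invg_mul mul_ref_ref // subnK // /dih mul1g xm.
Qed.

End DihedralElements.

(** * Fourier transform on sequences of period [m] and the kernel equations *)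

Section Fourier.
Local Open Scope ring_scope.
Variable m : nat.
Hypothesis m0 : (0 < m)%N.

Definition dft (p : nat -> algC) (w : algC) := \sum_(i < m) p i * w ^+ i.

Lemma dft_shift p a w : (forall i, p (i + m)%N = p i) -> w ^+ m = 1 ->
  \sum_(i < m) p (a + i)%N * w ^+ i = w^-1 ^+ a * dft p w.
Proof.
move=> per wm; elim: a p per => [|a IHa] p per; first by rewrite expr0 mul1r.
have w0 : w != 0.
  by apply/eqP => w0; move/eqP: wm; rewrite w0 expr0n gtn_eqF // eq_sym oner_eq0.
have -> : \sum_(i < m) p (a.+1 + i)%N * w ^+ i = \sum_(i < m) p (a + i).+1 * w ^+ i by [].
rewrite (IHa (fun i => p i.+1)) => [|i]; last by rewrite -addSn per.
rewrite exprSr -mulrA; congr (_ * _); apply: (mulfI w0); rewrite mulVKf //.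
rewrite /dft mulr_sumr; case: m m0 wm per => // k _ wm per.
rewrite big_ord_recr big_ord_recl /= addrC; congr (_ + _).
  by rewrite mulrCA -exprS wm -[k.+1]add0n per.
by apply: eq_bigr => i _; rewrite mulrCA -exprS.
Qed.

(** The polynomial with coefficients [p i] has size at most [m] and vanishes at [m] distinct roots
    of unity. *)
Lemma dft_inj p : (forall w, w ^+ m = 1 -> dft p w = 0) ->
  forall i, (i < m)%N -> p i = 0.
Proof.
move=> h i im; have [z zP] := C_prim_root_exists m0.
pose q := \poly_(i < m) p i.
suff q0 : q = 0 by have := coef_poly m p i; rewrite -/q q0 coef0 im.
apply: (@roots_geq_poly_eq0 _ q [seq z ^+ j | j <- iota 0 m]).
- apply/allP => _ /mapP[j _ ->]; rewrite /root horner_poly; apply/eqP/h.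
  by rewrite exprAC (prim_expr_order zP) expr1n.
- rewrite map_inj_in_uniq ?iota_uniq // => j k; rewrite !mem_iota !add0n => jm km /eqP.
  by rewrite (eq_prim_root_expr zP) !modn_small // => /eqP.
by rewrite size_map size_iota size_poly.
Qed.

(** Subtracting the multiple of [w0 ^+ i] that has the same transform at [w0] leaves a sequence
    whose transform is zero everywhere. Since [w0 ^+ 2 = 1], the character [w0 ^+ i] is its own
    inverse. *)
Lemma dft_supp1 p w0 : w0 ^+ 2 = 1 -> w0 ^+ m = 1 ->
  (forall w, w ^+ m = 1 -> w != w0 -> dft p w = 0) ->
  forall i, (i < m)%N -> p i = w0 ^+ i * p 0%N.
Proof.
move=> w02 w0m h.
have w0V i : w0 ^+ i * w0 ^+ i = 1 by rewrite -expr2 exprAC w02 expr1n.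
have mn0 : (m%:R : algC) != 0 by rewrite pnatr_eq0 -lt0n.
pose c := dft p w0 / m%:R.
have q0 : forall i, (i < m)%N -> p i - c * w0 ^+ i = 0.
  apply: dft_inj => w wm.
  have -> : dft (fun i => p i - c * w0 ^+ i) w = dft p w - c * \sum_(i < m) (w0 * w) ^+ i.
    rewrite /dft mulr_sumr -sumrB; apply: eq_bigr => i _.
    by rewrite mulrBl exprMn mulrA.
  have [->|ww0] := eqVneq w w0.
    rewrite (eq_bigr (fun _ => 1)) => [|i _]; last by rewrite exprMn w0V.
    by rewrite sumr_const card_ord divfK // subrr.
  rewrite h // sub0r; apply/eqP; rewrite oppr_eq0 mulf_eq0; apply/orP; right.
  have nz : w0 * w - 1 != 0.
    rewrite subr_eq0; apply: contra_neq ww0 => e.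
    by rewrite -[w]mul1r -[1](w0V 1%N) expr1 -mulrA e mulr1.
  rewrite -(mulrI_eq0 _ (mulfI nz)) -subrX1 exprMn wm w0m mulr1 subrr //.
move=> i im; have /eqP := q0 i im; rewrite subr_eq0 => /eqP ->.
by have /eqP := q0 _ m0; rewrite subr_eq0 => /eqP ->; rewrite expr0 mulr1 mulrC.
Qed.

(** [gsum A] and [gsum B] are the alpha and beta of the overview. *)
Definition gsum (s : seq nat) (w : algC) := \sum_(i <- s) w ^+ i.

Lemma gsum_flip s w : {in s, forall i, (i <= m)%N} -> w ^+ m = 1 ->
  \sum_(i <- s) w ^+ (m - i) = gsum s w^-1.
Proof.
move=> sm wm; rewrite /gsum big_seq [RHS]big_seq; apply: eq_bigr => i /sm im.
have w0 : w != 0.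
  by apply/eqP => w0; move/eqP: wm; rewrite w0 expr0n gtn_eqF // eq_sym oner_eq0.
apply: (mulfI (expf_neq0 i w0)).
by rewrite -exprD subnKC // wm -exprMn divff // expr1n.
Qed.

Definition symm_list (A : seq nat) := forall a, a \in A -> [/\ (0 < a)%N, (a < m)%N & (m - a)%N \in A].

Lemma symm_perm A : uniq A -> symm_list A -> perm_eq [seq (m - a)%N | a <- A] A.
Proof.
move=> uA sA; apply: uniq_perm => //.
  rewrite map_inj_in_uniq // => a b /sA[_ am _] /sA[_ bm _]. lia.
move=> a; apply/mapP/idP => [[b /sA[_ _ ?] ->] //|/sA[? ? ?]].
by exists (m - a)%N => //; lia.
Qed.

Lemma big_symm A (f : nat -> algC) : uniq A -> symm_list A ->
  \sum_(a <- A) f (m - a)%N = \sum_(a <- A) f a.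
Proof. by move=> uA sA; rewrite -[RHS](perm_big _ (symm_perm uA sA)) /= big_map. Qed.

Lemma gsum_symmV A w : uniq A -> symm_list A -> w ^+ m = 1 -> gsum A w^-1 = gsum A w.
Proof.
move=> uA sA wm; rewrite -gsum_flip // => [|a /sA[_ /ltnW//]].
exact: (big_symm (fun i => w ^+ i)).
Qed.

Lemma dft_conv s (g : nat -> nat) p w : (forall i, p (i + m)%N = p i) -> w ^+ m = 1 ->
  \sum_(i < m) (\sum_(a <- s) p (g a + i)%N) * w ^+ i = (\sum_(a <- s) w^-1 ^+ g a) * dft p w.
Proof.
move=> per wm.
under eq_bigr do rewrite mulr_suml.
rewrite exchange_big mulr_suml; apply: eq_bigr => a _; exact: dft_shift.
Qed.

Section DihedralKernel.
Variables (A B : seq nat) (w0 s : algC).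
Hypotheses (uA : uniq A) (sA : symm_list A) (Bm : {in B, forall b, (b < m)%N}).
Hypotheses (w02 : w0 ^+ 2 = 1) (w0m : w0 ^+ m = 1) (s2 : s ^+ 2 = 1).
Hypotheses (AB0 : gsum A w0 + s * gsum B w0 = 0) (A0 : gsum A w0 != 0).
Hypothesis ABn : forall w, w ^+ m = 1 -> w != w0 -> gsum A w ^+ 2 != gsum B w * gsum B w^-1.

(** The sequences [p] and [r] hold the values of a null vector on the two cosets of the rotations.
    The transform turns both convolution equations into a 2 by 2 linear system with determinant
    [gsum A w ^+ 2 - gsum B w * gsum B w^-1], so both transforms are supported at [w0]. There
    [gsum B w0 = - (s * gsum A w0)] with [gsum A w0] nonzero, which forces [r 0 = s * p 0]. *)
Lemma dihedral_kernel p r :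
  (forall i, p (i + m)%N = p i) -> (forall i, r (i + m)%N = r i) ->
  (forall i, \sum_(a <- A) p (a + i)%N + \sum_(b <- B) r (m - b + i)%N = 0) ->
  (forall i, \sum_(a <- A) r (m - a + i)%N + \sum_(b <- B) p (b + i)%N = 0) ->
  forall i, (i < m)%N -> p i = w0 ^+ i * p 0%N /\ r i = w0 ^+ i * (s * p 0%N).
Proof.
move=> pp pr e1 e2.
have Bm' : {in B, forall b, (b <= m)%N} by move=> b /Bm/ltnW.
have Am' : {in A, forall a, (a <= m)%N} by move=> a /sA[_ /ltnW].
have f1 w : w ^+ m = 1 -> gsum A w * dft p w + gsum B w * dft r w = 0.
  move=> wm; have wmV : w^-1 ^+ m = 1 by rewrite exprVn wm invr1.
  rewrite -(gsum_symmV uA sA wm) -[w in gsum B w]invrK -(gsum_flip Bm' wmV).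
  rewrite -(dft_conv A id pp wm) -(dft_conv B (fun b => m - b)%N pr wm) -big_split /=.
  by rewrite big1 // => i _; rewrite -mulrDl e1 mul0r.
have f2 w : w ^+ m = 1 -> gsum A w * dft r w + gsum B w^-1 * dft p w = 0.
  move=> wm; have wmV : w^-1 ^+ m = 1 by rewrite exprVn wm invr1.
  rewrite -[w in gsum A w]invrK -(gsum_flip Am' wmV).
  rewrite -(dft_conv A (fun b => m - b)%N pr wm) -(dft_conv B id pp wm) -big_split /=.
  by rewrite big1 // => i _; rewrite -mulrDl e2 mul0r.
have z w : w ^+ m = 1 -> w != w0 -> dft p w = 0 /\ dft r w = 0.
  move=> wm ww0; have := ABn wm ww0; have := f1 w wm; have := f2 w wm.
  move: (gsum A w) (gsum B w) (gsum B w^-1) (dft p w) (dft r w) => al be be' P R h2 h1.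
  rewrite -subr_eq0 => nz; split; apply: (mulfI nz); rewrite mulr0.
    transitivity (al * (al * P + be * R) - be * (al * R + be' * P)); first by ring.
    by rewrite h1 h2 !mulr0 subrr.
  transitivity (al * (al * R + be' * P) - be' * (al * P + be * R)); first by ring.
  by rewrite h1 h2 !mulr0 subrr.
have hp := dft_supp1 w02 w0m (fun w wm ww0 => (z w wm ww0).1).
have hr := dft_supp1 w02 w0m (fun w wm ww0 => (z w wm ww0).2).
have w0n0 : w0 != 0.
  by apply/eqP => w00; move/eqP: w02; rewrite w00 expr0n eq_sym oner_eq0.
have w0V : w0^-1 = w0 by apply: (mulfI w0n0); rewrite divff // -expr2 w02.
have r0 : r 0%N = s * p 0%N.
  have := e1 0%N.
  have -> : \sum_(a <- A) p (a + 0)%N = gsum A w0 * p 0%N.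
    rewrite /gsum mulr_suml big_seq [RHS]big_seq; apply: eq_bigr => a /sA[_ am _].
    by rewrite addn0 hp.
  have -> : \sum_(b <- B) r (m - b + 0)%N = gsum B w0 * r 0%N.
    rewrite -w0V -(gsum_flip Bm' w0m) mulr_suml big_seq [RHS]big_seq.
    apply: eq_bigr => b /Bm bm.
    (* For [b = 0] the index [m - b] equals [m], outside the range of [hr]; periodicity brings it
       back to 0. *)
    rewrite addn0; have [->|b0] := posnP b; last by rewrite hr //; lia.
    by rewrite subn0 w0m mul1r -[m]add0n pr.
  have sA0 : gsum B w0 = - (s * gsum A w0).
    have := AB0; move=> /(congr1 (fun x => s * x)); rewrite mulr0 mulrDr mulrA -expr2 s2 mul1r.
    by move/eqP; rewrite addrC addr_eq0 => /eqP.
  rewrite sA0 => h; apply: (mulfI A0); apply/eqP; rewrite -subr_eq0; apply/eqP.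
  have ss : s * s = 1 by rewrite -expr2.
  transitivity (- s * (gsum A w0 * p 0%N + - (s * gsum A w0) * r 0%N)
     + (1 - s * s) * gsum A w0 * r 0%N); first by ring.
  by rewrite h ss subrr !mulr0 !mul0r addr0.
by move=> i im; rewrite hp // hr // r0.
Qed.

End DihedralKernel.
End Fourier.

(** * Null vectors of Cayley graphs *)

Section CayleyKernel.
Local Open Scope ring_scope.
Variables (gT : finGroupType) (C : {set gT}).
Hypothesis CV : forall x, x \in C -> (x^-1)%g \in C.

(** Substituting [g = c * h] in the entry at [h] turns the condition [h * g^-1 \in C] into
    [c^-1 \in C], which is [c \in C] by [CV]. *)
Lemma cayley_kernelP (v : 'rV[algC]_#|gT|) :
  (v <= eigenspace (adj_matrix (cayley_adj C)) 0)%MS <->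
  forall h, \sum_(c in C) v 0 (enum_rank (c * h)%g) = 0.
Proof.
have key (h : gT) : (v *m adj_matrix (cayley_adj C)) 0 (enum_rank h) =
    \sum_(c in C) v 0 (enum_rank (c * h)%g).
  rewrite mxE (reindex enum_rank) /=; last first.
    by exists enum_val => ? _; rewrite ?enum_rankK ?enum_valK.
  rewrite (eq_bigr (fun g => if (h * g^-1)%g \in C then v 0 (enum_rank g) else 0)); last first.
    by move=> g _; rewrite mxE !enum_rankK /cayley_adj; case: ifP; rewrite ?mulr1 ?mulr0.
  rewrite -big_mkcond (reindex (fun c => c * h)%g) /=; last first.
    by exists (fun g => g * h^-1)%g => g _; rewrite ?mulgK ?mulgKV.
  apply: eq_bigl => c; rewrite invMg mulKVg.
  by apply/idP/idP => /CV //; rewrite invgK.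
split=> [/eigenspaceP e h|e]; first by rewrite -key e scale0r mxE.
apply/eigenspaceP/rowP => j; rewrite scale0r [RHS]mxE -[j]enum_valK.
by rewrite key e.
Qed.

Lemma cayley_nut (v : 'rV[algC]_#|gT|) :
  (2 <= #|gT|)%N -> (forall i, v 0 i != 0) ->
  (v <= eigenspace (adj_matrix (cayley_adj C)) 0)%MS ->
  (forall u : 'rV_#|gT|, (u <= eigenspace (adj_matrix (cayley_adj C)) 0)%MS -> (u <= v)%MS) ->
  nut_graph (cayley_adj C).
Proof.
move=> g2 vn0 vk uk; split=> //; last by exists v.
have -> : \rank (eigenspace (adj_matrix (cayley_adj C)) 0) = \rank v.
  apply/eqmx_rank/andP; split=> //; apply/row_subP => i; exact/uk/row_sub.
rewrite rank_rV; have i0 : 'I_#|gT| by apply: (@enum_rank gT 1%g).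
by case: eqP => // v0; have := vn0 i0; rewrite v0 mxE eqxx.
Qed.
End CayleyKernel.

Definition nut_realizable (n d : nat) : Prop :=
  exists (gT : finGroupType) (C : {set gT}),
    [/\ #|gT| = n,
        cyclic [set: gT] \/ ([set: gT] \isog 'D_n)%g,
        (1%g \notin C) /\ (forall x, x \in C -> (x^-1)%g \in C),
        regular_graph (cayley_adj C) d
      & nut_graph (cayley_adj C)].

(** * The nut criterion for dihedral Cayley graphs *)

Section DihedralNut.
Local Open Scope ring_scope.
Variables (m : nat) (A B : seq nat) (w0 s : algC).
Hypotheses (m1 : (1 < m)%N) (uA : uniq A) (sA : symm_list m A).
Hypotheses (uB : uniq B) (Bm : {in B, forall b, (b < m)%N}).
Hypotheses (w02 : w0 ^+ 2 = 1) (w0m : w0 ^+ m = 1) (s2 : s ^+ 2 = 1).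
Hypotheses (AB0 : gsum A w0 + s * gsum B w0 = 0) (A0 : gsum A w0 != 0).
Hypothesis ABn : forall w, w ^+ m = 1 -> w != w0 -> gsum A w ^+ 2 != gsum B w * gsum B w^-1.

(** The null vector takes the value [w0 ^+ i] at [x ^+ i] and [s * w0 ^+ i] at [y * x ^+ i], so it
    has no zero entry; [dihedral_kernel] shows that it spans the kernel. The sign [s] tells which of
    alpha + beta and alpha - beta vanishes at [w0]. *)
Lemma dihedral_nut : nut_realizable m.*2 (size A + size B).
Proof.
have m0 := ltnW m1.
have [x [y [xm y2 xy gen]]] := dihedral_generators m1.
have cardG : #|('D_(m.*2) : finGroupType)| = m.*2.
  by rewrite -cardsT; apply: card_dihedral.
pose D := dih x y.
have Dinj := dih_inj cardG gen.
have Dmod b i : D b (i %% m)%N = D b i := dih_modn y xm b i.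
have DP := dihP gen.
have Am : {in A, forall a, (a < m)%N} by move=> a /sA[].
have w0V i : w0 ^+ i * w0 ^+ i = 1 by rewrite -expr2 exprAC w02 expr1n.
have w0V' a : (a <= m)%N -> w0 ^+ (m - a) = w0 ^+ a.
  by move=> am; rewrite -[LHS]mulr1 -(w0V a) mulrA -exprD subnK // w0m mul1r.
have w0mod i : w0 ^+ (i %% m) = w0 ^+ i by rewrite expr_mod.
pose Cs := [seq D false a | a <- A] ++ [seq D true b | b <- B].
have uC : uniq Cs.
  rewrite cat_uniq; apply/and3P; split.
  - by rewrite map_inj_in_uniq // => a b /Am am /Am bm /(Dinj _ _ _ _ am bm)[].
  - by apply/hasPn => _ /mapP[b /Bm bm ->]; apply/mapP => -[a /Am am /(Dinj _ _ _ _ bm am)[]].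
  by rewrite map_inj_in_uniq // => a b /Bm am /Bm bm /(Dinj _ _ _ _ am bm)[].
pose C := [set c in Cs].
have CV c : c \in C -> (c^-1)%g \in C.
  rewrite !inE !mem_cat => /orP[] /mapP[a aA ->].
    have [_ /ltnW am maA] := sA aA.
    by rewrite (inv_rot y xm am) map_f.
  by rewrite (inv_ref xm y2 xy (ltnW (Bm aA))) map_f ?orbT.
have sumC (f : 'D_(m.*2) -> algC) : \sum_(c in C) f c =
    \sum_(a <- A) f (D false a) + \sum_(b <- B) f (D true b).
  transitivity (\sum_(c <- Cs) f c); last by rewrite big_cat !big_map.
  rewrite big_uniq //=.
  by apply: eq_bigl => c; rewrite inE.
exists 'D_(m.*2)%type, C; split=> //.
- by right; apply: isog_refl.
- split=> //; rewrite inE mem_cat negb_or; apply/andP; split; apply/mapP => -[a aA e].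
    have [a0 am _] := sA aA.
    have e1 : D false 0%N = D false a by rewrite -e /D /dih !expg0 mulg1.
    by have [_ a00] := Dinj _ _ _ _ m0 am e1; rewrite -a00 in a0.
  have e1 : D false 0%N = D true a by rewrite -e /D /dih !expg0 mulg1.
  by have [] := Dinj _ _ _ _ m0 (Bm aA) e1.
- move=> u; have -> : [set v | cayley_adj C u v] = (C :* u)%g.
    by apply/setP => v; rewrite inE mem_rcoset.
  by rewrite card_rcoset cardsE (card_uniqP uC) size_cat !size_map.
(* [F] reads off the coordinates of [g] and returns the entry of the null vector; the pick always
   succeeds because every element has coordinates. *)
pose sg (b : bool) : algC := if b then s else 1.
pose P g (q : bool * 'I_m) := g == D q.1 q.2.
pose q0 : bool * 'I_m := (false, Ordinal m0).
pose val (q : bool * 'I_m) := sg q.1 * w0 ^+ q.2.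
pose F g := val (odflt q0 [pick q | P g q]).
have FD b i : F (D b i) = sg b * w0 ^+ i.
  rewrite /F; case: pickP => [[b' i'] /eqP /= e|/(_ (b, Ordinal (ltn_pmod i m0)))] /=.
    have e' : D b (i %% m)%N = D b' i' by rewrite Dmod.
    have [-> eii] := Dinj _ _ _ _ (ltn_pmod i m0) (ltn_ord i') e'.
    by rewrite /val /= -eii w0mod.
  by rewrite /P /= Dmod eqxx.
pose v : 'rV[algC]_#|('D_(m.*2) : finGroupType)| := \row_i F (enum_val i).
have vE g : v 0 (enum_rank g) = F g by rewrite mxE enum_rankK.
have sn0 : s != 0 by apply/eqP => s0; move/eqP: s2; rewrite s0 expr0n eq_sym oner_eq0.
have w0n0 : w0 != 0 by apply/eqP => s0; move/eqP: w02; rewrite s0 expr0n eq_sym oner_eq0.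
apply: (@cayley_nut _ _ v).
- by rewrite cardG; lia.
- move=> i; rewrite mxE; have [b [j jm ->]] := DP (enum_val i).
  by rewrite FD mulf_neq0 ?expf_neq0 // /sg; case: (b); rewrite ?oner_eq0.
- apply/(cayley_kernelP CV) => h; rewrite sumC.
  under eq_bigr do rewrite vE. under [X in _ + X]eq_bigr do rewrite vE.
  have [[] [i im ->]] := DP h.
    under eq_big_seq => a aA.
      rewrite (mul_rot_ref xm xy _ (ltnW (Am a aA))) FD exprD (w0V' _ (ltnW (Am a aA))) mulrCA.
      over.
    under [X in _ + X]eq_big_seq => b bB.
      rewrite (mul_ref_ref xm y2 xy _ (ltnW (Bm bB))) FD exprD (w0V' _ (ltnW (Bm bB))) mulrCA.
      over.
    rewrite -!mulr_suml -/(gsum A w0) -/(gsum B w0) /= mul1r.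
    have := congr1 (fun z => z * s * w0 ^+ i) AB0; rewrite !mul0r => <-.
    have ss : s * s = 1 by rewrite -expr2.
    transitivity (gsum A w0 * s * w0 ^+ i + s * s * gsum B w0 * w0 ^+ i); last by ring.
    by rewrite ss; ring.
  under eq_bigr => a _.
    rewrite mul_rot_rot FD exprD mulrCA; over.
  under [X in _ + X]eq_bigr => b _.
    rewrite mul_ref_rot FD exprD mulrCA; over.
  rewrite -!mulr_suml -/(gsum A w0) -/(gsum B w0) /= mul1r.
  have := congr1 (fun z => z * w0 ^+ i) AB0; rewrite !mul0r => <-; ring.
move=> u /(cayley_kernelP CV) uk.
pose p i := u 0 (enum_rank (D false i)); pose r i := u 0 (enum_rank (D true i)).
have pp i : p (i + m)%N = p i by rewrite /p -Dmod modnDr Dmod.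
have pr i : r (i + m)%N = r i by rewrite /r -Dmod modnDr Dmod.
have e1 i : \sum_(a <- A) p (a + i)%N + \sum_(b <- B) r (b + i)%N = 0.
  rewrite -[RHS](uk (D false i)) sumC; congr (_ + _); apply: eq_bigr => a _.
    by rewrite mul_rot_rot.
  by rewrite mul_ref_rot.
have e2 i : \sum_(a <- A) r (m - a + i)%N + \sum_(b <- B) p (m - b + i)%N = 0.
  rewrite -[RHS](uk (D true i)) sumC; congr (_ + _); apply: eq_big_seq => a aA.
    by rewrite (mul_rot_ref xm xy _ (ltnW (Am a aA))).
  by rewrite (mul_ref_ref xm y2 xy _ (ltnW (Bm aA))).
(* The symmetry of [A] exchanges [a] with [m - a], which brings both equations to the form of
   [dihedral_kernel] with the roles of [p] and [r] swapped. *)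
have e1' i : \sum_(a <- A) r (a + i)%N + \sum_(b <- B) p (m - b + i)%N = 0.
  by rewrite -(big_symm m0 (fun a => r (a + i)%N) uA sA) e2.
have e2' i : \sum_(a <- A) p (m - a + i)%N + \sum_(b <- B) r (b + i)%N = 0.
  by rewrite (big_symm m0 (fun a => p (a + i)%N) uA sA) e1.
have K := dihedral_kernel m0 uA sA Bm w02 w0m s2 AB0 A0 ABn pr pp e1' e2'.
suff -> : u = (s * r 0%N) *: v by apply: scalemx_sub.
apply/rowP => j; rewrite -[j]enum_valK [RHS]mxE vE.
have [[] [i im ->]] := DP (enum_val j); rewrite FD.
  rewrite -/(r i) (K i im).1 /=.
  have ss : s * s = 1 by rewrite -expr2.
  by transitivity (s * s * (w0 ^+ i * r 0%N)); [rewrite ss mul1r | ring].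
by rewrite -/(p i) (K i im).2 /= mul1r mulrC.
Qed.
End DihedralNut.

(** * Congruences modulo 2 between algebraic integers *)

Section Parity.
Local Open Scope ring_scope.

(** Divisibility by 2 in the ring of all algebraic integers, so that no number field has to be
    fixed. *)
Definition even2 (x : algC) : bool := x / 2 \in Aint.

Lemma two_neq0 : (2 : algC) != 0. Proof. by rewrite pnatr_eq0. Qed.

Lemma even2D x y : even2 x -> even2 y -> even2 (x + y).
Proof. by rewrite /even2 mulrDl; apply: rpredD. Qed.

Lemma even2N x : even2 (- x) = even2 x.
Proof. by rewrite /even2 mulNr rpredN. Qed.

Lemma even2B x y : even2 x -> even2 y -> even2 (x - y).
Proof. by move=> ex ey; rewrite even2D ?even2N. Qed.

Lemma even2Ml x y : x \in Aint -> even2 y -> even2 (x * y).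
Proof. by move=> Zx; rewrite /even2 -mulrA; apply: rpredM. Qed.

Lemma even2_double x : x \in Aint -> even2 (2 * x).
Proof. by move=> Zx; rewrite /even2 mulrC mulKf ?two_neq0. Qed.

Lemma Aint_natr n : n%:R \in Aint.
Proof. by rewrite rpred_nat. Qed.

Lemma even2_nat n : even2 n%:R = ~~ odd n.
Proof.
rewrite -dvdn2 -eqAmod0_nat eqAmod0 unfold_in /= ifN //; exact: two_neq0.
Qed.

(** Every sign is congruent to 1 modulo 2. In the exclusions below this shows that a sum of an odd
    number of signs is nonzero. *)
Lemma even2_sign_sum (s : seq nat) :
  even2 (\sum_(c <- s) (-1) ^+ c) = ~~ odd (size s).
Proof.
rewrite -even2_nat; set x := \sum_(c <- s) _.
have e : even2 (x - (size s)%:R).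
  rewrite /x; elim: s {x} => [|c s IHs]; first by rewrite big_nil subrr /even2 mul0r rpred0.
  rewrite big_cons /= -nat1r opprD addrACA; apply: even2D.
    by rewrite -signr_odd; case: (odd c) => /=;
      rewrite ?subrr /even2 ?mul0r ?rpred0 // -opprD mulNr divff ?two_neq0 // rpredN rpred1.
  exact: IHs.
apply/idP/idP => h; first by have := even2B h e; rewrite opprB addrC subrK.
by have := even2D e h; rewrite subrK.
Qed.

Lemma Aint_root N (w : algC) : (0 < N)%N -> w ^+ N = 1 -> w \in Aint.
Proof. by move=> N0 wN; apply: (@Aint_unity_root N) => //; apply/unity_rootP. Qed.

Lemma root_neq0 N (w : algC) : (0 < N)%N -> w ^+ N = 1 -> w != 0.
Proof.
move=> N0 wN; apply/eqP => w0; move/eqP: wN.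
by rewrite w0 expr0n gtn_eqF // eq_sym oner_eq0.
Qed.

(* [1 - z] divides [u = \sum_(i < u) (1 - z ^+ i)]. *)
Lemma even2_cancel_sub1 u (z y : algC) : odd u -> z ^+ u = 1 -> z != 1 -> y \in Aint ->
  even2 ((z - 1) * y) -> even2 y.
Proof.
move=> uo zu z1 Zy e.
have u0 : (0 < u)%N by case: u uo {zu}.
have Zz : z \in Aint by apply: Aint_root zu.
have sum0 : \sum_(i < u) z ^+ i = 0.
  apply/eqP; rewrite -(mulrI_eq0 _ (mulfI (_ : z - 1 != 0))) ?subr_eq0 //.
  by rewrite -subrX1 zu subrr.
have [W ZW uW] : exists2 W, W \in Aint & u%:R = (z - 1) * W.
  exists (- \sum_(i < u) \sum_(j < i) z ^+ j).
    by rewrite rpredN; apply: rpred_sum => i _; apply: rpred_sum => j _; apply: rpredX.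
  rewrite mulrN mulr_sumr (eq_bigr (fun i : 'I_u => z ^+ i - 1)) => [|i _]; last by rewrite -subrX1.
  by rewrite sumrB sum0 sumr_const card_ord sub0r opprK.
have euy : even2 (u%:R * y) by rewrite uW mulrAC [_ * W]mulrC; apply: even2Ml.
(* As [u] is odd, [y] is congruent to [u * y] modulo 2. *)
have -> : y = u%:R * y - 2 * ((u./2)%:R * y).
  have -> : u%:R = 1 + 2 * (u./2)%:R :> algC.
    by rewrite -{1}(odd_double_half u) uo natrD -mul2n natrM.
  ring.
by apply: even2B => //; apply/even2_double/rpredM => //; apply: Aint_natr.
Qed.

(** The contribution of a pair +-c to alpha or beta; it is twice a cosine when [w] lies on the unit
    circle. *)
Definition cosum (c : nat) (w : algC) := w ^+ c + (w ^+ c)^-1.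

Lemma Aint_rootV N (w : algC) : (0 < N)%N -> w ^+ N = 1 -> w^-1 \in Aint.
Proof. by move=> N0 wN; apply: (@Aint_root N) => //; rewrite exprVn wN invr1. Qed.

Lemma Aint_cosum N c (w : algC) : (0 < N)%N -> w ^+ N = 1 -> cosum c w \in Aint.
Proof.
move=> N0 wN; rewrite /cosum -exprVn rpredD ?rpredX //; last exact: Aint_rootV wN.
exact: Aint_root wN.
Qed.

Lemma cosum_sqr c (w : algC) : w != 0 -> cosum c w ^+ 2 = cosum c (w ^+ 2) + 2.
Proof.
move=> w0; rewrite /cosum -exprM mulnC exprM.
have : w ^+ c != 0 by rewrite expf_neq0.
by move: (w ^+ c) => x x0; field.
Qed.

(** Squaring is additive modulo 2, and [cosum c w ^+ 2] is congruent to [cosum c (w ^+ 2)]. *)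
Lemma even2_frobenius N a b (w : algC) r : (0 < N)%N -> w ^+ N = 1 ->
  even2 (cosum a w + cosum b w) ->
  even2 (cosum a (w ^+ (2 ^ r)) + cosum b (w ^+ (2 ^ r))).
Proof.
move=> N0 wN e; elim: r => [|r]; first by rewrite expn0 expr1.
rewrite expnS mulnC [w ^+ (_ * 2)]exprM.
have : (w ^+ (2 ^ r)) ^+ N = 1 by rewrite exprAC wN expr1n.
move: (w ^+ _) => {e wN}w wN e.
have w0 := root_neq0 N0 wN.
have Za := Aint_cosum a N0 wN; have Zb := Aint_cosum b N0 wN.
have -> : cosum a (w ^+ 2) + cosum b (w ^+ 2) =
  (cosum a w + cosum b w) * (cosum a w + cosum b w) - 2 * (2 + cosum a w * cosum b w).
  have -> : cosum a (w ^+ 2) = cosum a w ^+ 2 - 2 by rewrite cosum_sqr // addrK.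
  have -> : cosum b (w ^+ 2) = cosum b w ^+ 2 - 2 by rewrite cosum_sqr // addrK.
  ring.
apply: even2B; first by apply: even2Ml => //; apply: rpredD.
by apply/even2_double/rpredD; rewrite ?rpredM ?(Aint_natr 2).
Qed.

Lemma even2_1 : even2 1 = false.
Proof. by rewrite (even2_nat 1). Qed.

(** With [x = z ^+ a] and [y = z ^+ b], the product [(x * y - 1) * (x / y - 1)] equals
    [x * (cosum a z - cosum b z)], hence is even. If [z] were not 1, neither factor would vanish,
    and [even2_cancel_sub1] would remove both, leaving 2 as a divisor of 1. *)
Lemma even2_cosum_odd_order u a b (z : algC) : odd u -> z ^+ u = 1 ->
  (z ^+ (a + b) = 1 -> z = 1) -> (z ^+ a = z ^+ b -> z = 1) ->
  even2 (cosum a z + cosum b z) -> z = 1.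
Proof.
move=> uo zu hs hd e; apply/eqP; apply: contraTT isT => z1.
have u0 : (0 < u)%N by case: u uo {zu}.
have z0 := root_neq0 u0 zu.
have Zz := Aint_root u0 zu; have ZzV := Aint_rootV u0 zu.
set x := z ^+ a in hd; set y := z ^+ b in hd.
have x0 : x != 0 by rewrite expf_neq0.
have y0 : y != 0 by rewrite expf_neq0.
have xu : x ^+ u = 1 by rewrite exprAC zu expr1n.
have yu : y ^+ u = 1 by rewrite exprAC zu expr1n.
have Zx := Aint_root u0 xu; have Zy := Aint_root u0 yu.
have ZxV := Aint_rootV u0 xu; have ZyV := Aint_rootV u0 yu.
have e1 : even2 ((x * y - 1) * ((x / y - 1) * 1)).
  have -> : (x * y - 1) * ((x / y - 1) * 1) = x * (cosum a z + cosum b z - 2 * cosum b z).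
    have aux (p q : algC) : p != 0 -> q != 0 ->
      (p * q - 1) * ((p / q - 1) * 1) = p * (p + p^-1 + (q + q^-1) - 2 * (q + q^-1)).
      by move=> p0 q0; field; apply/andP. 
    exact: aux.
  by apply: even2Ml => //; apply: even2B => //; apply/even2_double/(Aint_cosum _ u0).
have xyu : (x / y) ^+ u = 1 by rewrite exprMn exprVn xu yu invr1 mulr1.
have {}e1 : even2 ((x / y - 1) * 1).
  apply: (even2_cancel_sub1 uo) e1; first by rewrite exprMn xu yu mulr1.
    by rewrite -exprD; apply: contra_neq z1 => /hs.
  by rewrite mulr1 rpredB ?rpred1 // rpredM.
have : even2 1.
  apply: (even2_cancel_sub1 uo) e1; rewrite ?rpred1 //.
  apply: contra_neq z1 => e2; apply: hd.
  by rewrite -[x](divfK y0) e2 mul1r.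
by rewrite even2_1.
Qed.

Lemma sqrN1_sign_half (i : algC) c : i ^+ 2 = -1 -> ~~ odd c -> i ^+ c = (-1) ^+ c./2.
Proof. by move=> i2 ce; rewrite -{1}(even_halfK ce) -mul2n exprM i2. Qed.

Lemma cosum_i_even (i : algC) c : i ^+ 2 = -1 -> ~~ odd c -> cosum c i = 2 * (-1) ^+ c./2.
Proof.
by move=> i2 ce; rewrite /cosum (sqrN1_sign_half i2 ce) -exprVn invrN1; ring.
Qed.

Lemma cosum_i_odd (i : algC) c : i ^+ 2 = -1 -> odd c -> cosum c i = 0.
Proof.
move=> i2 co; rewrite /cosum.
have x2 : (i ^+ c) ^+ 2 = -1 by rewrite exprAC i2 -signr_odd co.
have x0 : i ^+ c != 0.
  by apply/eqP => x0; move/eqP: x2; rewrite x0 expr0n /= eq_sym oppr_eq0 oner_eq0.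
by apply: (mulfI x0); rewrite mulr0 mulrDr -expr2 x2 divff // addNr.
Qed.

Lemma cosum_N1 c : cosum c (-1) = 2 * (-1) ^+ c.
Proof. by rewrite /cosum -exprVn invrN1; ring. Qed.

Lemma even2_sqr2 (x : algC) : x ^+ 2 = 2 -> even2 x = false.
Proof.
move=> x2; apply: negbTE; apply/negP => e.
suff : even2 1 by rewrite even2_1.
rewrite /even2; suff -> : 1 / 2 = (x / 2) ^+ 2 by apply: rpredX.
by rewrite expr_div_n x2 expr2 invfM mulrA divff ?two_neq0.
Qed.

(** The term with even exponent is a [cosum] at [z ^+ 2], a square root of -1, hence 0 or +-2. The
    term with odd exponent has square 2, and an algebraic integer with square 2 is not even, since
    1/2 is not an algebraic integer. *)
Lemma even2_cosum_prim8 a b (z : algC) : z ^+ 4 = -1 -> odd (a + b) ->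
  even2 (cosum a z + cosum b z) = false.
Proof.
move=> z4.
wlog ae : a b / ~~ odd a.
  move=> h o; have [ao|ae] := boolP (odd a); last exact: h.
  by rewrite addrC h // 1?addnC //; move: o; rewrite oddD ao; case: odd.
rewrite oddD (negbTE ae) /= => bo.
have i2 : (z ^+ 2) ^+ 2 = -1 by rewrite -exprM.
have z8 : z ^+ 8 = 1 by rewrite (exprM z 4 2) z4 sqrrN expr1n.
have z0 := @root_neq0 8 z isT z8.
apply: negbTE; apply/negP => e.
have ea : even2 (cosum a z).
  have -> : cosum a z = cosum a./2 (z ^+ 2).
    by rewrite /cosum -exprM mul2n even_halfK.
  have [ho|he] := boolP (odd a./2); first by rewrite cosum_i_odd // /even2 mul0r rpred0.
  by rewrite cosum_i_even //; apply: even2_double; rewrite rpredX // rpredN rpred1.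
have := even2B e ea; rewrite addrC addrA addNr add0r even2_sqr2 //.
by rewrite cosum_sqr // cosum_i_odd // add0r.
Qed.

(** If the order is a power of 2 that is at least 8, repeated squaring reaches a primitive 8th root
    of unity. *)
Lemma exp2_root_cases t (w : algC) : w ^+ (2 ^ t) = 1 ->
  w ^+ 4 = 1 \/ exists r, (w ^+ (2 ^ r)) ^+ 4 = -1.
Proof.
elim: t => [|t IHt]; first by rewrite expr1 => ->; left; rewrite expr1n.
rewrite expnS mulnC exprM => /eqP; rewrite sqrf_eq1 => /orP[/eqP/IHt //|/eqP].
case: t {IHt} => [|[|t]] wN1.
- by left; rewrite -[w]expr1 wN1 -signr_odd.
- by left; rewrite (exprM w 2 2) wN1 sqrrN expr1n.
by right; exists t; rewrite -exprM -(expnD 2 t 2) addn2.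
Qed.

Lemma coprime_root1 u k (z : algC) : coprime u k -> z ^+ u = 1 -> z ^+ k = 1 -> z = 1.
Proof.
move=> cuk zu zk.
have [k0|k0] := posnP k; first by move: cuk zu; rewrite k0 /coprime gcdn0 => /eqP->.
have [x y exy _] := egcdnP u k0.
move: exy; rewrite gcdnC (eqP cuk) => exy.
have : z ^+ (x * k) = 1 by rewrite mulnC exprM zk expr1n.
by rewrite exy exprD mulnC exprM zu expr1n mul1r.
Qed.

Section Criterion.
Variables (t u a b : nat) (w : algC).
Hypotheses (uo : odd u) (wtu : w ^+ (2 ^ t * u) = 1).
Hypotheses (cs : coprime u (a + b)) (cd : coprime u (a - b + (b - a))).
Hypothesis ew : even2 (cosum a w + cosum b w).

Let N0 : (0 < 2 ^ t * u)%N.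
Proof. by rewrite muln_gt0 expn_gt0; case: u uo. Qed.

(** Raising [w] to the power [2 ^ t] leaves a root of unity of odd order dividing [u], to which
    [even2_cosum_odd_order] applies. Subtraction is truncated, so [a - b + (b - a)] is the distance
    between [a] and [b]. *)
Lemma even2_cosum_exp2_order : w ^+ (2 ^ t) = 1.
Proof.
have e := even2_frobenius t N0 wtu ew.
have zu : (w ^+ (2 ^ t)) ^+ u = 1 by rewrite -exprM.
have u0 : (0 < u)%N by case: u uo.
have z0 := root_neq0 u0 zu.
apply: (even2_cosum_odd_order uo zu _ _ e) => [|eab]; first exact: (coprime_root1 cs zu).
 apply: (coprime_root1 cd zu); move: eab.
case: (leqP b a) => [ba|/ltnW ab].
  rewrite (eqP ba) addn0 -{1}(subnK ba) exprD -{2}[_ ^+ b]mul1r.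
  by apply: mulIf; rewrite expf_neq0.
rewrite (eqP ab) add0n -{1}(subnK ab) exprD -{1}[_ ^+ a]mul1r => /esym.
by apply: mulIf; rewrite expf_neq0.
Qed.

Lemma even2_cosum_exp4 : odd (a + b) -> w ^+ 4 = 1.
Proof.
move=> oab; have [//|[r w8]] := exp2_root_cases even2_cosum_exp2_order.
by have := even2_frobenius r N0 wtu ew; rewrite even2_cosum_prim8.
Qed.

End Criterion.
End Parity.

(** * Connection sets made of pairs +-c, and degrees divisible by 4 *)

Section Constructions.
Local Open Scope ring_scope.

Definition cosums (L : seq nat) (w : algC) := \sum_(c <- L) cosum c w.

(** [L] lists representatives of distinct pairs +-c modulo [m]; 0 and [m / 2] are excluded because
    they are their own negatives. *)
Definition good (m : nat) (L : seq nat) :=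
  uniq L /\ {in L, forall c, (0 < c)%N && (c.*2 < m)%N}.

Definition symm m (L : seq nat) := L ++ [seq (m - c)%N | c <- L].

Lemma symm_uniq m L : good m L -> uniq (symm m L).
Proof.
case=> uL gL; rewrite cat_uniq uL /=; apply/andP; split.
  by apply/hasPn => _ /mapP[c /gL cm ->]; apply/negP => /gL; lia.
by rewrite map_inj_in_uniq // => a b /gL am /gL bm; lia.
Qed.

Lemma symm_symm m L : good m L -> symm_list m (symm m L).
Proof.
case=> uL gL a; rewrite !mem_cat => /orP[aL|/mapP[c cL ->]].
  by have := gL a aL; split; [lia | lia | rewrite map_f ?orbT].
by have := gL c cL; split; [lia | lia | rewrite subKn ?cL //; lia].
Qed.

Lemma size_symm m L : size (symm m L) = (size L).*2.
Proof. by rewrite size_cat size_map addnn. Qed.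

Lemma gsum_symm m L w : (0 < m)%N -> w ^+ m = 1 -> good m L -> gsum (symm m L) w = cosums L w.
Proof.
move=> m0 wm [_ gL]; have w0 := root_neq0 m0 wm.
rewrite /gsum /cosums big_cat big_map /= -big_split /= big_seq [RHS]big_seq.
apply: eq_bigr => c /gL cm; congr (_ + _).
apply: (mulfI (expf_neq0 c w0)); rewrite -exprD subnKC ?wm ?divff ?expf_neq0 //; lia.
Qed.

Lemma goodW m a L : good m (a :: L) -> good m L.
Proof.
by case=> /andP[_ uL] gL; split=> // c cL; apply: gL; rewrite inE cL orbT.
Qed.

Lemma good_swap m a b L : good m (a :: b :: L) -> good m (a :: L).
Proof.
case=> /=; rewrite inE negb_or => /andP[/andP[_ aL] /andP[_ uL]] gL; split; first by rewrite /= aL.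
by move=> c; rewrite inE => /orP[/eqP->|cL]; apply: gL; rewrite !inE ?eqxx // cL !orbT.
Qed.

Lemma gsum1 (L : seq nat) : gsum L 1 = (size L)%:R.
Proof.
rewrite /gsum (eq_bigr (fun _ => 1)) => [|i _]; last by rewrite expr1n.
by rewrite big_const_seq count_predT iter_addr_0.
Qed.

Lemma cosums_N1 L : cosums L (-1) = 2 * \sum_(c <- L) (-1) ^+ c.
Proof. by rewrite mulr_sumr; apply: eq_bigr => c _; rewrite cosum_N1. Qed.

Lemma cosums_i i L : i ^+ 2 = -1 ->
  cosums L i = 2 * \sum_(c <- [seq c./2 | c <- L & ~~ odd c]) (-1) ^+ c.
Proof.
move=> i2; rewrite big_map big_filter mulr_sumr [RHS]big_mkcond /=.
apply: eq_bigr => c _; case: ifP => [ce|/negbFE co]; first by rewrite cosum_i_even.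
by rewrite cosum_i_odd.
Qed.

Lemma Aint_sign_sum (L : seq nat) : \sum_(c <- L) (-1) ^+ c \in Aint.
Proof. by apply: rpred_sum => c _; rewrite rpredX // rpredN rpred1. Qed.

(** When [B] is symmetric too, [gsum B w^-1 = gsum B w], so the determinant factors as (alpha -
    beta)(alpha + beta). Equal sizes make alpha - beta vanish at [w0 = 1], whence [s = -1]. *)
Lemma nut_symm_even m L1 L2 : (1 < m)%N -> good m L1 -> good m L2 ->
  size L1 = size L2 -> (0 < size L1)%N ->
  (forall w, w ^+ m = 1 -> cosums L1 w = cosums L2 w \/ cosums L1 w = - cosums L2 w -> w = 1) ->
  nut_realizable m.*2 (4 * size L1).
Proof.
move=> m1 g1 g2 s12 s0 h; have m0 := ltnW m1.
have -> : (4 * size L1 = size (symm m L1) + size (symm m L2))%N.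
  by rewrite !size_symm s12; lia.
have S2 := symm_symm g2.
apply: (@dihedral_nut _ _ _ 1 (-1)); rewrite ?expr1n ?sqrrN ?expr1n ?symm_uniq //.
- exact: symm_symm.
- by move=> b /S2[].
- by rewrite !gsum1 !size_symm s12 mulN1r subrr.
- by rewrite gsum1 size_symm pnatr_eq0; lia.
move=> w wm; apply: contra_neqN => e; apply: (h w wm).
move: e; rewrite (gsum_symmV m0 (symm_uniq g2) S2 wm) !gsum_symm // -expr2 eqf_sqr.
by case/orP=> /eqP; [left | right].
Qed.

(** The central rotation [x ^+ h] joins [A] and the reflection [y] joins [B]. Both are involutions,
    so the sets stay symmetric and of equal size while the degree becomes 2 modulo 4; they
    contribute the terms [w ^+ h] and 1. *)
Lemma nut_symm_odd h L1 L2 : (1 < h)%N -> good h.*2 L1 -> good h.*2 L2 ->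
  size L1 = size L2 ->
  (forall w, w ^+ h.*2 = 1 -> cosums L1 w + w ^+ h = cosums L2 w + 1 \/
     cosums L1 w + w ^+ h = - (cosums L2 w + 1) -> w = 1) ->
  nut_realizable h.*2.*2 (4 * size L1 + 2).
Proof.
move=> h1 g1 g2 s12 H; have m0 : (0 < h.*2)%N by lia.
have S1 := symm_symm g1; have S2 := symm_symm g2.
have -> : (4 * size L1 + 2 = size (h :: symm h.*2 L1) + size (0%N :: symm h.*2 L2))%N.
  by rewrite /= !size_symm s12; lia.
apply: (@dihedral_nut _ _ _ 1 (-1)); rewrite ?expr1n ?sqrrN ?expr1n //; first by lia.
- rewrite /= symm_uniq // andbT mem_cat negb_or; case: g1 => _ gL.
  by apply/andP; split; [|apply/mapP => -[c]]; [apply/negP|]; move/gL; lia.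
- move=> a; rewrite !inE => /orP[/eqP->|/S1[? ? ->]]; last by rewrite orbT.
  by split; [lia | lia | apply/orP; left; apply/eqP; lia].
- by rewrite /= symm_uniq // andbT; apply/negP => /S2[].
- by move=> b; rewrite inE => /orP[/eqP-> //|/S2[]].
- by rewrite !gsum1 /= !size_symm s12 mulN1r subrr.
- by rewrite gsum1 /= pnatr_eq0.
move=> w wm; apply: contra_neqN => e; apply: (H w wm).
have gc f l x : gsum (f :: l) x = gsum l x + x ^+ f by rewrite /gsum big_cons addrC.
move: e; rewrite !gc !expr0 (gsum_symmV m0 (symm_uniq g2) S2 wm) !gsum_symm // -expr2 eqf_sqr.
by case/orP=> /eqP; [left | right].
Qed.

Lemma exp4_cases (w : algC) : w ^+ 4 = 1 -> [\/ w = 1, w = -1 | w ^+ 2 = -1].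
Proof.
rewrite (exprM w 2 2) => /eqP; rewrite sqrf_eq1 => /orP[|/eqP]; last by constructor 3.
by rewrite sqrf_eq1 => /orP[] /eqP; [constructor 1 | constructor 2].
Qed.

Lemma cosums_cons a L w : cosums (a :: L) w = cosum a w + cosums L w.
Proof. exact: big_cons. Qed.

Lemma Aint_cosums N L (w : algC) : (0 < N)%N -> w ^+ N = 1 -> cosums L w \in Aint.
Proof. by move=> N0 wN; apply: rpred_sum => c _; apply: Aint_cosum N0 wN. Qed.

(** The shared list [S] cancels from alpha = beta and is doubled in alpha = - beta. Either way it
    disappears modulo 2, as do the extra terms [e1] and [e2]. *)
Lemma even2_shared N a b S (w e1 e2 : algC) : (0 < N)%N -> w ^+ N = 1 ->
  e1 \in Aint -> e2 \in Aint -> even2 (e1 + e2) ->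
  cosums (a :: S) w + e1 = cosums (b :: S) w + e2 \/
  cosums (a :: S) w + e1 = - (cosums (b :: S) w + e2) ->
  even2 (cosum a w + cosum b w).
Proof.
move=> N0 wN Z1 Z2 ee; rewrite !cosums_cons.
have Za := Aint_cosum a N0 wN; have Zb := Aint_cosum b N0 wN.
have ZS := Aint_cosums S N0 wN.
move: (cosum a w) (cosum b w) (cosums S w) Za Zb ZS => x y z Zx Zy Zz [e|e].
  have -> : x + y = 2 * (y + e2) - (e1 + e2).
    have -> : x = (x + z + e1) - (z + e1) by ring.
    by rewrite e; ring.
  by apply: even2B => //; apply/even2_double/rpredD.
have -> : x + y = - (2 * z) - (e1 + e2).
  have -> : x = (x + z + e1) - (z + e1) by ring.
  by rewrite e; ring.
by apply: even2B => //; rewrite even2N; apply: even2_double.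
Qed.

Lemma signr_opp a b : odd (a + b) -> (-1) ^+ b = - (-1) ^+ a :> algC.
Proof.
by rewrite oddD -[in LHS]signr_odd -[in RHS]signr_odd; case: (odd a); case: (odd b) => //= _;
  rewrite ?expr0 ?expr1 ?opprK.
Qed.

Lemma mulf_sign_neq0 (c : algC) a : c != 0 -> c * (-1) ^+ a != 0.
Proof. by move=> c0; rewrite mulf_neq0 // signr_eq0. Qed.

(** The criterion leaves [w ^+ 4 = 1], which for odd [m] gives [w = 1]. At [w = -1] the difference
    of the two sums is +-4, and their sum is 4 times a sum of [size S] signs, an odd number. At
    [w = +-i] one of the two [cosum] terms is 0 and the other +-2, so the difference is +-2 and the
    sum is twice an odd algebraic integer. *)
Lemma nut_shared_even m t u a b S : m = (2 ^ t * u)%N -> odd u ->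
  coprime u (a + b) -> coprime u (a - b + (b - a)) -> odd (a + b) ->
  good m (a :: b :: S) -> odd m || odd (size S) ->
  nut_realizable m.*2 (4 * (size S).+1).
Proof.
move=> mE uo cs cd oab gm par.
have m1 : (1 < m)%N by case: gm => _ /(_ a); rewrite inE eqxx => /(_ isT); lia.
have m0 := ltnW m1.
apply: (@nut_symm_even m (a :: S) (b :: S)) => //; first exact: good_swap gm.
  exact: goodW gm.
move=> w wm xy.
have e : even2 (cosum a w + cosum b w).
  apply: (@even2_shared m a b S w 0 0); rewrite ?rpred0 ?addr0 //.
  by rewrite /even2 mul0r rpred0.
have wm' : w ^+ (2 ^ t * u) = 1 by rewrite -mE.
have w4 := even2_cosum_exp4 uo wm' cs cd e oab.
have [om|em] := boolP (odd m).
  apply: (@coprime_root1 m (2 ^ 2)) => //; rewrite coprimeXr // coprimen2 //.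
rewrite (negbTE em) /= in par.
have [//|wE|i2] := exp4_cases w4; exfalso; move: xy; rewrite !cosums_cons.
  rewrite wE cosums_N1 !cosum_N1 (signr_opp oab).
  set s := \sum_(c <- S) _; case=> /eqP; rewrite -subr_eq0.
    have -> : 2 * (-1) ^+ a + 2 * s - (2 * - (-1) ^+ a + 2 * s) = 4 * (-1) ^+ a :> algC by ring.
    by apply/negP/mulf_sign_neq0; rewrite pnatr_eq0.
  have -> : 2 * (-1) ^+ a + 2 * s - - (2 * - (-1) ^+ a + 2 * s) = 4 * s :> algC by ring.
  rewrite mulf_eq0 pnatr_eq0 /= => /eqP s0.
  by have := even2_sign_sum S; rewrite -/s s0 par /even2 mul0r rpred0.
rewrite (cosums_i _ i2); set s := \sum_(c <- _) _.
have Zs : s \in Aint by apply: Aint_sign_sum.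
have key x : ~ (2 * (-1) ^+ x + 2 * s = 0 + 2 * s \/ 2 * (-1) ^+ x + 2 * s = - (0 + 2 * s) :> algC).
  case=> /eqP; rewrite -subr_eq0.
    have -> : 2 * (-1) ^+ x + 2 * s - (0 + 2 * s) = 2 * (-1) ^+ x :> algC by ring.
    by apply/negP/mulf_sign_neq0; rewrite pnatr_eq0.
  have -> : 2 * (-1) ^+ x + 2 * s - - (0 + 2 * s) = 2 * ((-1) ^+ x + 2 * s) :> algC by ring.
  rewrite mulf_eq0 pnatr_eq0 /= addrC addr_eq0 => /eqP s0.
  have := even2_double Zs; rewrite s0 even2N => e1.
  have := even2_sign_sum [:: x]; rewrite big_seq1 e1 //.
have [ao|ae] := boolP (odd a); last first.
  rewrite (cosum_i_even i2 ae) (cosum_i_odd (c := b) i2); first exact: key.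
  by move: oab; rewrite oddD (negbTE ae).
rewrite (cosum_i_odd i2 ao) (cosum_i_even (c := b) i2); last first.
  by move: oab; rewrite oddD ao; case: odd.
case=> E; apply: (key b./2); [left | right]; first by rewrite E.
by rewrite E opprK.
Qed.
End Constructions.

(** * Degrees 2 modulo 4, and sets [B] symmetric about a half-integer *)

Section OddConstructions.
Local Open Scope ring_scope.

Lemma half_turn h (w : algC) : w ^+ h.*2 = 1 -> w ^+ h = 1 \/ w ^+ h = -1.
Proof. by rewrite -muln2 exprM => /eqP; rewrite sqrf_eq1 => /orP[]/eqP; [left | right]. Qed.

Lemma even2_shared_odd h a b S (w : algC) : (0 < h)%N -> w ^+ h.*2 = 1 ->
  cosums (a :: S) w + w ^+ h = cosums (b :: S) w + 1 \/
  cosums (a :: S) w + w ^+ h = - (cosums (b :: S) w + 1) ->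
  even2 (cosum a w + cosum b w).
Proof.
move=> h0 wm; apply: (@even2_shared h.*2) => //; rewrite ?rpred1 //; first by lia.
  by have [->|->] := half_turn wm; rewrite ?rpredN rpred1.
by have [->|->] := half_turn wm; rewrite ?addNr -?natr1 ?(even2_nat 2) // /even2 mul0r rpred0.
Qed.

(** Here [m = 2 * u] has 2-part 2, so only [w = -1] remains. If [a + b] is odd, the [a] and [b]
    terms cancel in alpha + beta, leaving 4 times a sum of [size S] signs; if it is even, they agree
    and add one sign. The parity condition makes the number of signs odd in both cases. *)
Lemma nut_shared_odd_2mod4 u a b S : odd u -> (1 < u)%N ->
  coprime u (a + b) -> coprime u (a - b + (b - a)) -> odd (a + b) = odd (size S) ->
  good u.*2 (a :: b :: S) ->
  nut_realizable u.*2.*2 (4 * (size S).+1 + 2).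
Proof.
move=> uo u1 cs cd oab gm; have u0 := ltnW u1.
apply: (@nut_symm_odd u (a :: S) (b :: S)) => //; first exact: good_swap gm.
  exact: goodW gm.
move=> w wm xy.
have e := even2_shared_odd u0 wm xy.
have wm' : w ^+ (2 ^ 1 * u) = 1 by rewrite expn1 mul2n.
have := even2_cosum_exp2_order uo wm' cs cd e.
rewrite expn1 => /eqP; rewrite sqrf_eq1 => /orP[/eqP //|/eqP wE]; exfalso.
move: xy; rewrite wE !cosums_cons cosums_N1 !cosum_N1 -[_ ^+ u]signr_odd uo expr1.
set s := \sum_(c <- S) _.
have sP := even2_sign_sum S; rewrite -/s in sP.
have [oab1|eab1] := boolP (odd (a + b)).
  rewrite (signr_opp oab1); case=> /eqP; rewrite -subr_eq0.
    have -> : 2 * (-1) ^+ a + 2 * s + -1 - (2 * - (-1) ^+ a + 2 * s + 1)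
       = 2 * (2 * (-1) ^+ a - 1) :> algC by ring.
    rewrite mulf_eq0 pnatr_eq0 /= subr_eq0 => /eqP e1.
    have : even2 1 by rewrite -e1; apply: even2_double; rewrite rpredX // rpredN rpred1.
    by rewrite even2_1.
  have -> : 2 * (-1) ^+ a + 2 * s + -1 - - (2 * - (-1) ^+ a + 2 * s + 1)
     = 4 * s :> algC by ring.
  rewrite mulf_eq0 pnatr_eq0 /= => /eqP s0.
  by move: sP; rewrite s0 -oab oab1 /even2 mul0r rpred0.
have eab : (-1) ^+ b = (-1) ^+ a :> algC.
  move: eab1; rewrite oddD -[in X in _ -> X]signr_odd -[in RHS]signr_odd.
  by case: (odd a); case: (odd b).
rewrite eab; case=> /eqP; rewrite -subr_eq0.
  have -> : 2 * (-1) ^+ a + 2 * s + -1 - (2 * (-1) ^+ a + 2 * s + 1) = - 2 :> algC by ring.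
  by rewrite oppr_eq0 pnatr_eq0.
have -> : 2 * (-1) ^+ a + 2 * s + -1 - - (2 * (-1) ^+ a + 2 * s + 1)
     = 4 * (s + (-1) ^+ a) :> algC by ring.
rewrite mulf_eq0 pnatr_eq0 /= addr_eq0 => /eqP s0.
by move: sP; rewrite s0 -oab (negbTE eab1) even2N; have := even2_sign_sum [:: a]; rewrite big_seq1 => ->.
Qed.

(* If [h] is divisible by 4, the parity of the number of even entries of [S] excludes [alpha = - beta]
   at [w = +-i]. *)
Lemma nut_shared_odd_0mod4 t u h a b S : h.*2 = (2 ^ t * u)%N -> odd u -> ~~ odd h ->
  coprime u (a + b) -> coprime u (a - b + (b - a)) -> ~~ odd a -> odd b ->
  good h.*2 (a :: b :: S) -> odd h./2 = odd a./2 ->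
  odd h./2 || ~~ odd (count (fun c => ~~ odd c) S) ->
  nut_realizable h.*2.*2 (4 * (size S).+1 + 2).
Proof.
move=> mE uo he cs cd ae bo gm hah par.
have h1 : (1 < h)%N by case: gm => _ /(_ a); rewrite inE eqxx => /(_ isT); lia.
have h0 := ltnW h1.
have oab : odd (a + b) by rewrite oddD (negbTE ae) bo.
apply: (@nut_symm_odd h (a :: S) (b :: S)) => //; first exact: good_swap gm.
  exact: goodW gm.
move=> w wm xy.
have e := even2_shared_odd h0 wm xy.
have wm' : w ^+ (2 ^ t * u) = 1 by rewrite -mE.
have w4 := even2_cosum_exp4 uo wm' cs cd e oab.
have [//|wE|i2] := exp4_cases w4; exfalso; move: xy; rewrite !cosums_cons.
  rewrite wE cosums_N1 !cosum_N1 (signr_opp oab) -[_ ^+ h]signr_odd (negbTE he) expr0.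
  set s := \sum_(c <- S) _; case=> /eqP; rewrite -subr_eq0.
    have -> : 2 * (-1) ^+ a + 2 * s + 1 - (2 * - (-1) ^+ a + 2 * s + 1) = 4 * (-1) ^+ a :> algC by ring.
    by apply/negP/mulf_sign_neq0; rewrite pnatr_eq0.
  have -> : 2 * (-1) ^+ a + 2 * s + 1 - - (2 * - (-1) ^+ a + 2 * s + 1) = 2 * (2 * s + 1) :> algC by ring.
  rewrite mulf_eq0 pnatr_eq0 /= addr_eq0 => /eqP s0.
  have := even2_double (Aint_sign_sum S); rewrite -/s s0 even2N even2_1 //.
(* By [hah] the numbers [w ^+ h] and [cosum a w / 2] are the same sign e, so alpha - beta is 3e - 1,
   which is never 0. *)
rewrite (cosums_i _ i2) (cosum_i_even i2 ae) (cosum_i_odd i2 bo) (sqrN1_sign_half i2 he).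
rewrite -[(-1) ^+ h./2]signr_odd hah -[(-1) ^+ a./2]signr_odd -hah add0r.
set s := \sum_(c <- _) _.
have sP := even2_sign_sum [seq c./2 | c <- S & ~~ odd c].
rewrite -/s size_map size_filter in sP.
have Zs : s \in Aint by apply: Aint_sign_sum.
have {par} := par; case: (odd h./2) => /= par; rewrite ?expr0 ?expr1.
  case=> /eqP; rewrite -subr_eq0.
    have -> : 2 * -1 + 2 * s + -1 - (2 * s + 1) = - 4 :> algC by ring.
    by rewrite oppr_eq0 pnatr_eq0.
  have -> : 2 * -1 + 2 * s + -1 - - (2 * s + 1) = 2 * (2 * s - 1) :> algC by ring.
  rewrite mulf_eq0 pnatr_eq0 /= subr_eq0 => /eqP s0.
  by have := even2_double Zs; rewrite s0 even2_1.
case=> /eqP; rewrite -subr_eq0.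
  have -> : 2 * 1 + 2 * s + 1 - (2 * s + 1) = 2 :> algC by ring.
  by rewrite pnatr_eq0.
have -> : 2 * 1 + 2 * s + 1 - - (2 * s + 1) = 4 * (s + 1) :> algC by ring.
rewrite mulf_eq0 pnatr_eq0 /= addr_eq0 => /eqP s0.
by move: sP; rewrite s0 even2N even2_1 par.
Qed.

(* Here [B] is symmetric about a half-integer: with [z ^+ 2 = w], [gsum A w] and [z * gsum B w]
   are sums over even and odd exponents of [z]. *)
Lemma nut_half_integer h j : (2 <= h)%N -> (j < h./2)%N ->
  nut_realizable h.*2.*2 (8 * j + 4).
Proof.
move=> h2 jq.
(* In exponents of [z], the pairs in [LA] are 2x and m - 2x, those in [LB] are 2x + 1 and m - (2x +
   1). The unpaired middle elements [q] and [b0] give the exponents 2q and 2 b0 + 1, which differ by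
   1 and add up to m - 1. *)
set q := h./2 in jq; set b0 := (h.-1)./2; set m := h.*2.
pose LA := q :: (iota 1 j ++ [seq (h - x)%N | x <- iota 1 j]).
pose LB := b0 :: (iota 0 j ++ [seq (h.-1 - x)%N | x <- iota 0 j]).
have m0 : (0 < m)%N by lia.
have gA : good m LA.
  split.
    rewrite /= mem_cat mem_iota negb_or cat_uniq iota_uniq /= -andbA; apply/and4P; split.
    - lia.
    - by apply/mapP => -[x]; rewrite mem_iota; lia.
    - by apply/hasPn => y /mapP[x]; rewrite mem_iota => xj ->; rewrite mem_iota; lia.
    by rewrite map_inj_in_uniq ?iota_uniq // => x y; rewrite !mem_iota; lia.
  move=> c; rewrite inE mem_cat => /or3P[/eqP->|| /mapP[x]]; rewrite ?mem_iota; lia.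
have uLB : uniq LB.
  rewrite /= mem_cat mem_iota negb_or cat_uniq iota_uniq /= -andbA; apply/and4P; split.
  - lia.
  - by apply/mapP => -[x]; rewrite mem_iota; lia.
  - by apply/hasPn => y /mapP[x]; rewrite mem_iota => xj ->; rewrite mem_iota; lia.
  by rewrite map_inj_in_uniq ?iota_uniq // => x y; rewrite !mem_iota; lia.
have LBh : {in LB, forall b, (b < h)%N}.
  move=> c; rewrite inE mem_cat => /or3P[/eqP->|| /mapP[x]]; rewrite ?mem_iota; lia.
pose B := LB ++ [seq (m.-1 - b)%N | b <- LB].
have sB : size B = (j.*2.+1).*2 by rewrite size_cat size_map /= size_cat size_map size_iota; lia.
have sA : size (symm m LA) = (j.*2.+1).*2 by rewrite size_symm /= size_cat size_map size_iota; lia.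
have -> : (8 * j + 4 = size (symm m LA) + size B)%N by rewrite sA sB; lia.
have SA := symm_symm gA.
have gB w z : z ^+ 2 = w -> w ^+ m = 1 -> gsum B w = z^-1 * \sum_(b <- LB) cosum b.*2.+1 z.
  move=> zw wm.
  have z2m : z ^+ m.*2 = 1 by rewrite -mul2n exprM zw.
  have z0 : z != 0 by apply: (root_neq0 _ z2m); lia.
  rewrite /gsum big_cat big_map /= -big_split /= mulr_sumr big_seq [RHS]big_seq.
  apply: eq_bigr => b /LBh bh; apply: (mulfI z0); rewrite mulVKf // mulrDr -zw -!exprM -!exprS.
  congr (_ ^+ _ + _); first by lia.
  apply: (mulfI (expf_neq0 b.*2.+1 z0)).
  rewrite -exprD divff ?expf_neq0 // -z2m; congr (_ ^+ _); lia.
apply: (@dihedral_nut _ _ _ 1 (-1)); rewrite ?expr1n ?sqrrN ?expr1n ?symm_uniq //; first by lia.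
- rewrite cat_uniq uLB andTb; apply/andP; split.
    by apply/hasPn => _ /mapP[x /LBh xh ->]; apply/negP => /LBh; lia.
  by rewrite map_inj_in_uniq // => x y /LBh xh /LBh yh; lia.
- by move=> b; rewrite mem_cat => /orP[/LBh|/mapP[x /LBh xh ->]]; lia.
- by rewrite !gsum1 sA sB mulN1r subrr.
- by rewrite gsum1 sA pnatr_eq0.
move=> w wm; apply: contra_neqN => /eqP e.
pose z := sqrtC w; have zw : z ^+ 2 = w by apply: sqrtCK.
have z2m : z ^+ m.*2 = 1 by rewrite -mul2n exprM zw.
have m20 : (0 < m.*2)%N by lia.
have z0 : z != 0 := root_neq0 m20 z2m.
have wVm : w^-1 ^+ m = 1 by rewrite exprVn wm invr1.
have zVw : z^-1 ^+ 2 = w^-1 by rewrite exprVn zw.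
have cosumV c x : cosum c x^-1 = cosum c x by rewrite /cosum -!exprVn invrK addrC.
pose beta := \sum_(b <- LB) cosum b.*2.+1 z.
have gBV : gsum B w^-1 = z * beta.
  by rewrite (gB _ _ zVw wVm) invrK; congr (_ * _); apply: eq_bigr => b _; rewrite cosumV.
have gAz : gsum (symm m LA) w = \sum_(c <- LA) cosum c.*2 z.
  by rewrite gsum_symm //; apply: eq_bigr => c _; rewrite /cosum -zw -exprM mul2n.
have e2 : gsum (symm m LA) w = beta \/ gsum (symm m LA) w = - beta.
  move/eqP: e; rewrite gBV (gB _ _ zw wm) -/beta mulrACA mulVf // mul1r -expr2 eqf_sqr.
  by case/orP=> /eqP; [left | right].
have Zc c : cosum c z \in Aint := Aint_cosum c m20 z2m.
(* Since [z ^+ m] is 1 or -1, [cosum (m - c) z] is [cosum c z] up to sign, so each pair is even and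
   only the two middle terms survive modulo 2. *)
have flip c : (c <= m)%N -> even2 (cosum c z + cosum (m - c) z).
  move=> cm; have : cosum (m - c) z = z ^+ m * cosum c z.
    have zm : (z ^+ m)^-1 = z ^+ m.
      by have [->|->] := half_turn z2m; rewrite ?invr1 ?invrN1.
    have zc := expf_neq0 c z0; have zmc := expf_neq0 (m - c) z0.
    have zE : z ^+ m = z ^+ c * z ^+ (m - c) by rewrite -exprD subnKC.
    rewrite /cosum mulrDr -{1}zm zE; field; exact/andP.
  have [->|->] := half_turn z2m => ->; rewrite ?mul1r ?mulN1r ?subrr.
    by rewrite -mulr2n -mulr_natl; apply: even2_double.
  by rewrite /even2 mul0r rpred0.
have eA : even2 (gsum (symm m LA) w - cosum q.*2 z).
  rewrite gAz big_cons [cosum _ _ + _]addrC addrK big_cat big_map /= -big_split /= big_seq.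
  elim/big_ind : _ => [||x]; [by rewrite /even2 mul0r rpred0 | exact: even2D |].
  by rewrite mem_iota => xj; rewrite doubleB; apply: flip; lia.
have eB : even2 (beta - cosum b0.*2.+1 z).
  rewrite /beta big_cons [cosum _ _ + _]addrC addrK big_cat big_map /= -big_split /= big_seq.
  elim/big_ind : _ => [||x]; [by rewrite /even2 mul0r rpred0 | exact: even2D |].
  rewrite mem_iota => xj; have -> : ((h.-1 - x).*2.+1 = m - x.*2.+1)%N by lia.
  by apply: flip; lia.
have Zbeta : beta \in Aint by apply: rpred_sum => b _; apply: Zc.
have ez : even2 (cosum q.*2 z + cosum b0.*2.+1 z).
  have -> : cosum q.*2 z + cosum b0.*2.+1 z = (gsum (symm m LA) w + beta)
    - (gsum (symm m LA) w - cosum q.*2 z) - (beta - cosum b0.*2.+1 z) by ring.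
  do 2!(apply: even2B => //).
  have [->|->] := e2; last by rewrite addNr /even2 mul0r rpred0.
  by rewrite -mulr2n -mulr_natl; apply: even2_double.
have [u cu mE] := pfactor_coprime (isT : prime 2) m20.
rewrite coprime2n in cu.
have z2t : z ^+ (2 ^ logn 2 m.*2 * u) = 1 by rewrite mulnC -mE.
(* The odd part [u] of [2 * m] divides [m], so it is prime to [m - 1], the sum of the two middle
   exponents. *)
have cu1 : coprime u m.-1.
  have um : (u %| m)%N.
    by rewrite -(@Gauss_dvdr _ 2) ?coprimen2 // mul2n mE dvdn_mulr.
  apply: (coprime_dvdl um); by rewrite -{1}(prednK m0) coprimeSn.
have z4 : z ^+ 4 = 1.
  apply: (even2_cosum_exp4 cu z2t _ _ ez); last by lia.
    by have -> : (q.*2 + b0.*2.+1 = m.-1)%N by lia.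
  have -> : (q.*2 - b0.*2.+1 + (b0.*2.+1 - q.*2) = 1)%N by lia.
  exact: coprimen1.
apply/eqP; apply: contraTT isT => w1.
have wN1 : w = -1.
  by move/eqP: z4; rewrite (exprM z 2 2) zw sqrf_eq1 (negbTE w1) => /eqP.
(* Now [z ^+ 2 = -1]: all exponents in [beta] are odd, so [beta] vanishes, whereas alpha is twice a
   sum of [2 * j + 1] signs. *)
have beta0 : beta = 0.
  by apply: big1 => b _; apply: cosum_i_odd; rewrite ?zw //= odd_double.
have : gsum (symm m LA) w = 0 by case: e2; rewrite beta0 ?oppr0.
rewrite gsum_symm // wN1 cosums_N1 => /eqP; rewrite mulf_eq0 pnatr_eq0 /= => /eqP s0.
have := even2_sign_sum LA; rewrite s0 /= size_cat size_map size_iota addnn odd_double /=.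
by rewrite /even2 mul0r rpred0.
Qed.
End OddConstructions.

(** * Degree [n - 4], and the orders 12 and 16 *)

Section SporadicCases.
Local Open Scope ring_scope.

(** In this degree [a :: b :: S] would need [u] pairs, but there are only [u - 1]. Instead [A] and
    [B] are all nonzero residues except [u] and 2 respectively, so that away from [w = 1] the sums
    are [- (1 + w ^+ u)] and [- (1 + w ^+ 2)]. If [w ^+ u = 1], equality forces [w ^+ 2 = 1]; if
    [w ^+ u = -1], it forces [w ^+ 2 = -1], impossible for odd [u]. *)
Lemma nut_near_complete u : odd u -> (1 < u)%N -> nut_realizable u.*2.*2 (4 * u.-1).
Proof.
move=> uo u1; set m := u.*2; have u3 : (2 < u)%N by case: u uo u1 {m} => [|[|[|]]].
have m0 : (0 < m)%N by lia.
pose I := iota 1 m.-1.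
have uI : uniq I := iota_uniq _ _.
have mI c : (c \in I) = (0 < c)%N && (c < m)%N by rewrite mem_iota; lia.
pose A := rem u I; pose B := rem 2%N I.
have uA : u \in I by rewrite mI; lia.
have uB : 2%N \in I by rewrite mI; lia.
have gR c w : c \in I -> w ^+ m = 1 -> w != 1 -> gsum (rem c I) w = - (1 + w ^+ c).
  move=> cI wm w1.
  have : gsum (iota 0 m) w = 0.
    apply/eqP; rewrite -(mulrI_eq0 _ (mulfI (_ : w - 1 != 0))) ?subr_eq0 //.
    by rewrite /gsum -[m]subn0 big_mkord -subrX1 wm subrr.
  rewrite -{1}(prednK m0) /= -/I /gsum big_cons expr0 (big_rem c) //= => /eqP.
  by rewrite addrA addrC addr_eq0 => /eqP.
have sR c : c \in I -> size (rem c I) = (m - 2)%N by move=> cI; rewrite size_rem // size_iota; lia.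
have -> : (4 * u.-1 = size A + size B)%N by rewrite !sR //; lia.
apply: (@dihedral_nut _ _ _ 1 (-1)); rewrite ?expr1n ?sqrrN ?expr1n ?rem_uniq //; first by lia.
- move=> a; rewrite !mem_rem_uniq // !inE !mI => /andP[/eqP au am].
  by split; [lia | lia | apply/andP; split; [apply/eqP; lia | lia]].
- by move=> b; rewrite mem_rem_uniq // inE mI => /and3P[].
- by rewrite !gsum1 !sR // mulN1r subrr.
- by rewrite gsum1 sR // pnatr_eq0; lia.
move=> w wm w1; have w0 := root_neq0 m0 wm.
have wVm : w^-1 ^+ m = 1 by rewrite exprVn wm invr1.
have wV1 : w^-1 != 1 by rewrite invr_eq1.
rewrite !gR // exprVn mulrNN sqrrN; apply: contra_neq w1 => e.
have := half_turn wm; case=> wu; rewrite wu in e.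
  have : (w ^+ 2 - 1) ^+ 2 = 0.
    have w20 : w ^+ 2 != 0 by rewrite expf_neq0.
    transitivity (w ^+ 2 * ((1 + w ^+ 2) * (1 + (w ^+ 2)^-1) - (1 + 1) ^+ 2)); first by field.
    by rewrite -e subrr mulr0.
  move/eqP; rewrite sqrf_eq0 subr_eq0 => /eqP w2.
  by apply: (@coprime_root1 u 2); rewrite ?coprimen2.
move: e; rewrite subrr expr0n /= => /esym/eqP.
have -> : (1 + w ^+ 2) * (1 + (w ^+ 2)^-1) = (1 + w ^+ 2) ^+ 2 * (w ^+ 2)^-1.
  have w20 : w ^+ 2 != 0 by rewrite expf_neq0.
  by field.
rewrite mulf_eq0 sqrf_eq0 invr_eq0 expf_eq0 (negbTE w0) andbF orbF addrC addr_eq0 => /eqP w2.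
have := congr1 (fun x => x ^+ u) w2; rewrite exprAC wu sqrrN expr1n -signr_odd uo expr1 => /eqP.
by rewrite -addr_eq0 -(natrD _ 1 1) pnatr_eq0.
Qed.

(** For [h = 3] and empty [S] the only choice of [a], [b] is 1, 2, whose sum has the wrong parity
    for [nut_shared_odd_2mod4]. The sets below are checked at each sixth root of unity. *)
Lemma nut_12_6 : nut_realizable 12 6.
Proof.
apply: (@dihedral_nut 6 [:: 3; 1; 5]%N [:: 0; 1; 3]%N 1 (-1)) => //;
  rewrite ?expr1n ?sqrrN ?expr1n //.
- by move=> a; rewrite !inE => /or3P[] /eqP->.
- by move=> b; rewrite !inE => /or3P[] /eqP->.
- by rewrite !gsum1 /= mulN1r subrr.
- by rewrite gsum1 pnatr_eq0.
move=> w w6 w1; have w0 : w != 0 := @root_neq0 6 w isT w6.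
set v := w^-1; have wv : w * v = 1 by rewrite divff.
have w5 : w ^+ 5 = v by apply: (mulfI w0); rewrite wv -exprS.
rewrite /gsum !big_cons !big_nil w5 !expr0 !expr1 !addr0.
have [w3|w3] := half_turn (h := 3) w6.
  have q0 : 1 + w + w ^+ 2 = 0.
    apply: (mulfI (_ : w - 1 != 0)); first by rewrite subr_eq0.
    by rewrite mulr0; transitivity (w ^+ 3 - 1); [ring | rewrite w3 subrr].
  have v2 : v = w ^+ 2 by rewrite -w5 (exprD w 3 2) w3 mul1r.
  have v3 : v ^+ 3 = 1 by rewrite exprVn w3 invr1.
  rewrite v3 w3.
  have -> : 1 + (w + v) = 0 by rewrite addrA v2.
  have -> : (1 + (w + 1)) * (1 + (v + 1)) = 3 + 2 * (1 + w + v) + (w * v - 1) :> algC by ring.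
  by rewrite v2 q0 -v2 wv subrr mulr0 !addr0 expr0n eq_sym pnatr_eq0.
have v3 : v ^+ 3 = -1 by rewrite exprVn w3 invrN1.
rewrite w3 v3.
have : (w + 1) * (1 - w + w ^+ 2) = 0.
  by transitivity (w ^+ 3 + 1); [ring | rewrite w3 addNr].
move/eqP; rewrite mulf_eq0 addr_eq0 => /orP[/eqP wN|/eqP q0].
  rewrite /v wN invrN1 -subr_eq0.
  have -> : (-1 + (-1 + -1)) ^+ 2 - (1 + (-1 + -1)) * (1 + (-1 + -1)) = 8 :> algC by ring.
  by rewrite pnatr_eq0.
have v2 : v = - w ^+ 2 by rewrite -w5 (exprD w 3 2) w3 mulN1r.
have -> : -1 + (w + v) = 0.
  by rewrite v2; transitivity (- (1 - w + w ^+ 2)); [ring | rewrite q0 oppr0].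
have -> : (1 + (w + -1)) * (1 + (v + -1)) = w * v by ring.
by rewrite wv expr0n eq_sym oner_eq0.
Qed.

(* An exhaustive search shows that in order 16 and degree 6 no choice with [|A| = |B|] works:
   here the null vector is attached to [w = -1]. *)
Section Order16.
Variable w : algC.
Hypotheses (w8 : w ^+ 8 = 1) (wN1 : w != -1).

Let v := w^-1.
Let w0 : w != 0 := @root_neq0 8 w isT w8.
Let wv : w * v = 1. Proof. exact: divff. Qed.
Let w7 : w ^+ 7 = v. Proof. by apply: (mulfI w0); rewrite wv -exprS. Qed.

Let root8_cases : [\/ w = 1, w ^+ 2 = -1 /\ v = - w | w ^+ 4 = -1 /\ v = - w ^+ 3].
Proof.
have [|w4] := half_turn (h := 4) w8; last first.
  by constructor 3; split=> //; rewrite -w7 (exprD w 4 3) w4 mulN1r.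
case/exp4_cases=> [?|/eqP|w2]; [by constructor 1 | by rewrite (negbTE wN1) |].
constructor 2; split=> //.
by rewrite -w7; transitivity (w * (w ^+ 2) ^+ 3); [ring | rewrite w2; ring].
Qed.

Let B := [:: 0; 1; 2; 4]%N.

Let gsumB_i : w ^+ 2 = -1 -> v = - w -> gsum B w * gsum B v = 2.
Proof.
move=> w2 vE; rewrite /gsum /B !big_cons !big_nil vE.
transitivity ((1 + w ^+ 2 + (w ^+ 2) ^+ 2) ^+ 2 - w ^+ 2); first by ring.
by rewrite w2; ring.
Qed.

Let gsumB_8 : w ^+ 4 = -1 -> gsum B w * gsum B v = 2 + (w + v).
Proof.
move=> w4; have v4 : v ^+ 4 = -1 by rewrite exprVn w4 invrN1.
rewrite /gsum /B !big_cons !big_nil w4 v4.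
by transitivity (w * v + w * v * v + w * v * w + (w * v) ^+ 2); [ring | rewrite wv; ring].
Qed.

Let sqr_sum8 : w ^+ 4 = -1 -> (w + v) ^+ 2 = 2.
Proof.
move=> w4; have -> : (w + v) ^+ 2 = w ^+ 2 + v ^+ 2 + 2 * (w * v) by ring.
have -> : v ^+ 2 = - w ^+ 2.
  by rewrite -w7; transitivity (w ^+ 4 * w ^+ 4 * w ^+ 4 * w ^+ 2); [ring | rewrite w4; ring].
by rewrite wv; ring.
Qed.

Lemma gsum_order16_1 : gsum [:: 1; 7]%N w ^+ 2 != gsum B w * gsum B w^-1.
Proof.
rewrite -/v; have -> : gsum [:: 1; 7]%N w = w + v by rewrite /gsum !big_cons big_nil w7 addr0.
case: root8_cases => [w1|[w2 vE]|[w4 _]].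
- rewrite /v w1 invr1 gsum1 /= -subr_eq0.
  have -> : (1 + 1) ^+ 2 - 4 * 4 = - 12 :> algC by ring.
  by rewrite oppr_eq0 pnatr_eq0.
- by rewrite (gsumB_i w2 vE) vE subrr expr0n eq_sym pnatr_eq0.
rewrite (gsumB_8 w4) (sqr_sum8 w4) -subr_eq0 opprD addrA subrr sub0r oppr_eq0.
by rewrite -sqrf_eq0 (sqr_sum8 w4) pnatr_eq0.
Qed.

Lemma gsum_order16_2 : gsum [:: 1; 2; 3; 5; 6; 7]%N w ^+ 2 != gsum B w * gsum B w^-1.
Proof.
rewrite -/v; case: root8_cases => [w1|[w2 vE]|[w4 vE]].
- rewrite /v w1 invr1 !gsum1 /= -subr_eq0.
  have -> : 6 ^+ 2 - 4 * 4 = 20 :> algC by ring.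
  by rewrite pnatr_eq0.
- rewrite (gsumB_i w2 vE) /gsum !big_cons big_nil w7 vE -subr_eq0.
  set x := _ ^+ 2 - 2; have -> : x = (w ^+ 2 + w * w ^+ 2 + w * (w ^+ 2) ^+ 2 + (w ^+ 2) ^+ 3) ^+ 2 - 2.
    by rewrite /x; ring.
  have -> : (w ^+ 2 + w * w ^+ 2 + w * (w ^+ 2) ^+ 2 + (w ^+ 2) ^+ 3) ^+ 2 - 2 = 2.
    by rewrite w2; ring.
  by rewrite pnatr_eq0.
have -> : gsum [:: 1; 2; 3; 5; 6; 7]%N w = 0.
  rewrite /gsum !big_cons big_nil w7 vE.
  by transitivity ((1 + w ^+ 4) * (w + w ^+ 2)); [ring | rewrite w4 subrr mul0r].
rewrite (gsumB_8 w4) expr0n eq_sym addrC addr_eq0; apply/eqP => e.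
have /eqP := sqr_sum8 w4; rewrite e -subr_eq0.
have -> : (- 2) ^+ 2 - 2 = 2 :> algC by ring.
by rewrite pnatr_eq0.
Qed.
End Order16.

Let B := [:: 0; 1; 2; 4]%N.

(** At -1 the set [B] sums to 1 - 1 + 1 + 1 = 2, so alpha + beta vanishes there and [s = 1]. *)
Lemma nut_order16 A : uniq A -> symm_list 8 A -> gsum A (-1) = -2 ->
  (forall w, w ^+ 8 = 1 -> w != -1 -> gsum A w ^+ 2 != gsum B w * gsum B w^-1) ->
  nut_realizable 16 (size A + 4).
Proof.
move=> uA sA AN1 h; apply: (@dihedral_nut 8 A B (-1) 1) => //.
- by move=> b; rewrite !inE => /or4P[] /eqP->.
- by rewrite sqrrN expr1n.
- by rewrite -signr_odd expr0.
- by rewrite expr1n.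
- by rewrite AN1 /gsum !big_cons big_nil; ring.
by rewrite AN1 oppr_eq0 pnatr_eq0.
Qed.

Lemma nut_16_6 : nut_realizable 16 6.
Proof.
apply: (@nut_order16 [:: 1; 7]%N) => //; last exact: gsum_order16_1.
  by move=> a; rewrite !inE => /orP[] /eqP->.
by rewrite /gsum !big_cons big_nil; ring.
Qed.

Lemma nut_16_10 : nut_realizable 16 10.
Proof.
apply: (@nut_order16 [:: 1; 2; 3; 5; 6; 7]%N) => //; last exact: gsum_order16_2.
  by move=> a; rewrite !inE; do ?case/orP; move/eqP->.
by rewrite /gsum !big_cons big_nil; ring.
Qed.
End SporadicCases.

(** * Choice of [a], [b], [S] and the case distinction *)

Section Assembly.

Lemma choose_good m a b p : a != b -> 0 < a -> a.*2 < m -> 0 < b -> b.*2 < m ->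
  p + 2 <= (m.-1)./2 -> exists2 S, size S = p & good m (a :: b :: S).
Proof.
move=> ab a0 am b0 bm pm.
pose I := iota 1 (m.-1)./2.
have uI : uniq I := iota_uniq _ _.
have mI c : (c \in I) = (0 < c) && (c.*2 < m) by rewrite mem_iota; lia.
have aI : a \in I by rewrite mI a0.
have bI : b \in rem a I by rewrite mem_rem_uniq // inE mI b0 bm eq_sym ab.
pose S := take p (rem b (rem a I)).
have SP c : c \in S -> [&& c != b, c != a & c \in I].
  by move/mem_take; rewrite !mem_rem_uniq ?rem_uniq // !inE mem_rem_uniq.
exists S; first by rewrite size_takel // !size_rem // size_iota; lia.
split.
  rewrite /= !inE negb_or ab /= take_uniq ?rem_uniq // andbT.
  by apply/andP; split; apply/negP => /SP; rewrite eqxx ?andbF.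
by move=> c; rewrite !inE => /or3P[/eqP->|/eqP->|/SP/and3P[_ _]]; rewrite ?mI ?a0 ?b0.
Qed.

(** Besides [b] and 4 there are [2 * v - 1] odd and [2 * v - 2] even candidates. Odd ones alone are
    used while they suffice; after that all odd ones, or all but one when [p] is even, so that the
    number of even ones added is even. *)
Lemma choose_good_even v b p : 1 < v -> odd b -> b.*2 < 8 * v -> p + 2 <= (8 * v).-1./2 ->
  exists S, [/\ size S = p, good (8 * v) [:: 4, b & S] & ~~ odd (count (fun c => ~~ odd c) S)].
Proof.
move=> v1 bo bm pm.
pose O := rem b [seq i.*2.+1 | i <- iota 0 (2 * v)].
pose E := rem 4 [seq i.*2.+2 | i <- iota 0 (2 * v).-1].
have uO' : uniq [seq i.*2.+1 | i <- iota 0 (2 * v)].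
  by rewrite map_inj_uniq ?iota_uniq // => x y; lia.
have uE' : uniq [seq i.*2.+2 | i <- iota 0 (2 * v).-1].
  by rewrite map_inj_uniq ?iota_uniq // => x y; lia.
have OP c : c \in O -> [/\ c != b, odd c, 0 < c & c.*2 < 8 * v].
  rewrite mem_rem_uniq // inE => /andP[cb /mapP[x]]; rewrite mem_iota => xv cE.
  by split => //; lia.
have EP c : c \in E -> [/\ c != 4, ~~ odd c, 0 < c & c.*2 < 8 * v].
  rewrite mem_rem_uniq // inE => /andP[cb /mapP[x]]; rewrite mem_iota => xv cE.
  by split => //; lia.
have sO : size O = (2 * v).-1.
  rewrite size_rem ?size_map ?size_iota //; apply/mapP; exists b./2; last by lia.
  by rewrite mem_iota; lia.
have sE : size E = (2 * v).-2.
  by rewrite size_rem ?size_map ?size_iota //; apply/mapP; exists 1; rewrite ?mem_iota; lia.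
have uO : uniq O by rewrite rem_uniq.
have uE : uniq E by rewrite rem_uniq.
have main O' E' : {subset O' <= O} -> {subset E' <= E} -> uniq O' -> uniq E' ->
    good (8 * v) [:: 4, b & O' ++ E'] /\ count (fun c => ~~ odd c) (O' ++ E') = size E'.
  move=> sO' sE' uO1 uE1; split; last first.
    rewrite count_cat (_ : count _ O' = 0); last first.
      by apply/eqP; rewrite -leqn0 leqNgt -has_count; apply/hasPn => c /sO'/OP[_ ->].
    by apply/eqP; rewrite -all_count; apply/allP => c /sE'/EP[].
  split.
    rewrite /= inE !mem_cat !negb_or cat_uniq uO1 uE1 /= andbT.
    apply/and3P; split; last 1 first.
    - by apply/hasPn => c /sE'/EP[_ ce _ _]; apply/negP => /sO'/OP[]; rewrite (negbTE ce).
    - apply/and3P; split; first by apply/eqP => b4; rewrite -b4 in bo.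
        by apply/negP => /sO'/OP[].
      by apply/negP => /sE'/EP[]; rewrite eqxx.
    apply/andP; split; first by apply/negP => /sO'/OP[]; rewrite eqxx.
    by apply/negP => /sE'/EP[_]; rewrite bo.
  move=> c; rewrite !inE mem_cat => /or4P[/eqP->|/eqP->|/sO'/OP[_ _ -> ->]|/sE'/EP[_ _ -> ->]] //; lia.
have tS (s : seq nat) k : {subset take k s <= s} by move=> x; apply: mem_take.
have bS (s : seq nat) : {subset behead s <= s} by move=> x; apply: mem_behead.
have buO : uniq (behead O) by move: uO; case: (O) => //= ? ? /andP[].
have [pO|pO] := leqP p (2 * v).-1.
  have [//|//|||g c] := main (take p O) [::]; rewrite ?take_uniq //.
  by exists (take p O ++ [::]); split=> //; rewrite ?c // cats0 size_takel ?sO.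
have [po|pe] := boolP (odd p).
  have [//|//|||g c] := main O (take (p - (2 * v).-1) E); rewrite ?take_uniq //.
  exists (O ++ take (p - (2 * v).-1) E); split=> //.
    by rewrite size_cat size_takel ?sO ?sE; lia.
  by rewrite c size_takel ?sE; lia.
have [//|//|||g c] := main (behead O) (take (p - (2 * v).-2) E); rewrite ?take_uniq //.
exists (behead O ++ take (p - (2 * v).-2) E); split=> //.
  by rewrite size_cat size_behead size_takel ?sO ?sE; lia.
by rewrite c size_takel ?sE; lia.
Qed.

Lemma coprime_dist u c : coprime u c -> coprime u (c - u + (u - c)).
Proof.
rewrite /coprime; have [cu|/ltnW cu] := leqP c u.
  rewrite (eqP cu) add0n -(subnK cu); move: (u - c) => r.
  by rewrite addnK [gcdn _ c]gcdnC gcdnDr [gcdn (r + c) r]gcdnC gcdnDl gcdnC.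
by rewrite (eqP cu) addn0 -{1}(subnKC cu) gcdnDl.
Qed.

Lemma coprime_odd_exp2 u i : odd u -> coprime u (2 ^ i).
Proof. by move=> uo; rewrite coprimeXr // coprimen2. Qed.

Lemma coprime_sub2 u : odd u -> 2 <= u -> coprime u (u - 2).
Proof.
move=> uo u2; rewrite -{1}(subnK u2) /coprime gcdnC gcdnDl -/(coprime _ _) coprimen2; lia.
Qed.

Lemma odd_part m : 0 < m -> exists t u, m = 2 ^ t * u /\ odd u.
Proof.
move=> m0; have [u cu mE] := pfactor_coprime (isT : prime 2) m0.
by exists (logn 2 m), u; rewrite mulnC -coprime2n.
Qed.

Lemma nut_m_odd m k : odd m -> ~~ odd k -> 2 <= k -> k + 2 <= m -> nut_realizable m.*2 (2 * k).
Proof.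
move=> mo ke k2 km.
(* Consecutive numbers with sum [m - 2]: sum and distance are odd and prime to the odd [m]. *)
pose a := (m - 3)./2; pose b := (m - 1)./2.
have [||||||S sS gS] := @choose_good m a b k./2.-1; try lia.
have -> : 2 * k = 4 * (size S).+1 by rewrite sS; lia.
apply: (@nut_shared_even m 0 m a b S) => //; rewrite ?expn0 ?mul1n ?mo //; last by lia.
  have -> : a + b = m - 2 by lia.
  by apply: coprime_sub2; lia.
by have -> : a - b + (b - a) = 1 by [lia]; rewrite coprimen1.
Qed.

Lemma nut_m_even_k_even h k : 4 %| k -> 2 <= k -> k + 2 <= h.*2 -> nut_realizable h.*2.*2 (2 * k).
Proof.
move=> k4 k2 kh.
have [ho|he] := boolP (odd h).
  have [kE|kE] := eqVneq k h.*2.-2.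
    by have -> : 2 * k = 4 * h.-1 by [lia]; apply: nut_near_complete => //; lia.
  pose a := (h - 3)./2; pose b := (h - 1)./2.
  have [||||||S sS gS] := @choose_good h.*2 a b k./2.-1; try lia.
  have -> : 2 * k = 4 * (size S).+1 by rewrite sS; lia.
  apply: (@nut_shared_even h.*2 1 h a b S) => //; rewrite ?sS; try lia.
    have -> : a + b = h - 2 by lia.
    by apply: coprime_sub2; lia.
  by have -> : a - b + (b - a) = 1 by [lia]; rewrite coprimen1.
have [|t [u [mE uo]]] := @odd_part h.*2; first by lia.
have [v hE] : exists v, h.*2 = 4 * (v * u).
  case: t mE => [|[|t]]; rewrite ?expn0 ?expn1 => mE; [lia | lia |].
  by exists (2 ^ t); rewrite mE !expnS !mulnA.
have v0 : 0 < v by case: (v) hE => //; lia.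
have uv : u <= v * u by rewrite leq_pmull.
(* With [a = 2] and [b = u], the sum [u + 2] and the distance of [u] from 2 are odd and prime to the
   odd part [u]. *)
have [||||||S sS gS] := @choose_good h.*2 2 u k./2.-1; try lia.
have -> : 2 * k = 4 * (size S).+1 by rewrite sS; lia.
apply: (@nut_shared_even h.*2 t u 2 u S) => //; rewrite ?sS; try lia.
  by rewrite /coprime gcdnDr -/(coprime _ _) coprimen2.
by apply: coprime_dist; rewrite coprimen2.
Qed.

Lemma nut_m_even_k_odd h k : odd k -> 2 <= k -> k + 2 <= h.*2 -> nut_realizable h.*2.*2 (2 * k).
Proof.
move=> ko k2 kh.
have dE p : p = (k - 3)./2 -> 2 * k = 4 * p.+1 + 2 by lia.
have [ho|he] := boolP (odd h).
  have [hE|h3] := eqVneq h 3.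
    by have -> : k = 3 by [lia]; rewrite hE; apply: nut_12_6.
  (* The parity of [size S] prescribes that of [a + b]: the sum is [h - 2] with distance 1, or
     [h - 1] with distance 2, all prime to the odd [h]. *)
  have [po|pe] := boolP (odd (k - 3)./2).
    pose a := (h - 3)./2; pose b := (h - 1)./2.
    have [||||||S sS gS] := @choose_good h.*2 a b (k - 3)./2; try lia.
    rewrite (dE _ sS); apply: (@nut_shared_odd_2mod4 h a b S) => //; rewrite ?sS; try lia.
      have -> : a + b = h - 2 by lia.
      by apply: coprime_sub2; lia.
    by have -> : a - b + (b - a) = 1 by [lia]; rewrite coprimen1.
  pose a := (h - 3)./2; pose b := h.+1./2.
  have [||||||S sS gS] := @choose_good h.*2 a b (k - 3)./2; try lia.
  rewrite (dE _ sS); apply: (@nut_shared_odd_2mod4 h a b S) => //; rewrite ?sS; try lia.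
    by have -> : a + b = h.-1 by [lia]; apply: coprimenP; lia.
  by have -> : a - b + (b - a) = 2 by [lia]; rewrite coprimen2.
(* For [h = 4] the condition [odd h./2 = odd a./2] would require a multiple of 4 strictly between 0
   and 4. *)
have [hE|h4] := eqVneq h 4.
  have [->|->] : k = 3 \/ k = 5 by lia.
    by rewrite hE; apply: nut_16_6.
  by rewrite hE; apply: nut_16_10.
have [h2o|h2e] := boolP (odd h./2).
  pose u := h./2; have hE : h = u.*2 by lia.
  have [||||||S sS gS] := @choose_good h.*2 2 u (k - 3)./2; try lia.
  rewrite (dE _ sS).
  apply: (@nut_shared_odd_0mod4 2 u h 2 u S) => //; rewrite ?sS; try lia.
    by rewrite /coprime gcdnDr -/(coprime _ _) coprimen2.
  by apply: coprime_dist; rewrite coprimen2.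
have [|t [u [mE uo]]] := @odd_part h.*2; first by lia.
have [v hE] : exists v, h.*2 = 8 * (v * u).
  case: t mE => [|[|[|t]]]; rewrite ?expn0 ?expn1 => mE; [lia | lia | lia |].
  by exists (2 ^ t); rewrite mE !expnS !mulnA.
have v0 : 0 < v by case: (v) hE => //; lia.
have uv : u <= v * u by rewrite leq_pmull.
(* Here 4 divides [h], so [a./2] must be even: [a = 4] is taken, with [b = u] as before. *)
have [||||S [sS gS eS]] := @choose_good_even (v * u) u (k - 3)./2; try lia.
rewrite (dE _ sS); rewrite -hE in gS.
apply: (@nut_shared_odd_0mod4 t u h 4 u S) => //; rewrite ?sS; try lia.
  by rewrite /coprime gcdnDr -/(coprime _ (2 ^ 2)) coprime_odd_exp2.
by apply: coprime_dist; rewrite (coprime_odd_exp2 2 uo).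
Qed.
End Assembly.

Theorem mainTheorem17 (n d : nat) :
  ~~ odd n -> ~~ odd d -> (4 %| n) || (4 %| d) ->
  4 <= d -> d + 4 <= n ->
  exists (gT : finGroupType) (C : {set gT}),
    [/\ #|gT| = n,
        cyclic [set: gT] \/ ([set: gT] \isog 'D_n)%g,
        (1%g \notin C) /\ (forall x, x \in C -> (x^-1)%g \in C),
        regular_graph (cayley_adj C) d
      & nut_graph (cayley_adj C)].
Proof.
move=> ne de nd d4 dn; rewrite -/(nut_realizable n d).
pose m := n./2; pose k := d./2.
have -> : n = m.*2 by lia.
have -> : d = 2 * k by lia.
(* If [m] is odd, then 4 does not divide [n], so it divides [d] and [k] is even. For even [m] the
   cases are [k] odd, [k] divisible by 4, and [k] congruent to 2 modulo 4, the last with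
   [j = (k - 2) / 4] in [nut_half_integer]. *)
have [mo|me] := boolP (odd m); first by apply: nut_m_odd => //; lia.
pose h := m./2; have -> : m = h.*2 by lia.
have [ko|ke] := boolP (odd k); first by apply: nut_m_even_k_odd => //; lia.
have [k4|k4] := boolP (4 %| k); first by apply: nut_m_even_k_even => //; lia.
have -> : 2 * k = 8 * (k - 2) %/ 4 + 4 by lia.
have -> : 8 * (k - 2) %/ 4 = 8 * ((k - 2) %/ 4) by lia.
by apply: nut_half_integer; lia.
Qed.
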